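(* Let $\theta_0,\sigma_0^2>0$ and let $Y$ be a centered Gaussian process on $[0,1]$ with covariance function $\sigma_0^2 e^{-\theta_0|t_1-t_2|}$. For each $n$ let $0=s_1<\dots<s_n=1$ be a design (depending on $n$), with $\Delta_i=s_i-s_{i-1}$, and assume $\limsup_{n\to\infty}\max_{i=2,\dots,n}\Delta_i=0$. Let $0<a\le A<\infty$, $0<b\le B<\infty$ and $J=[a,A]\times[b,B]$. Let $S_n(\theta,\sigma^2)$ be the leave-one-out logarithmic score defined in the context. Assume that there exists $(\tilde\theta,\tilde\sigma^2)\in J$ with $\tilde\theta\tilde\sigma^2=\theta_0\sigma_0^2$. Define $(\hat\theta,\hat\sigma^2)\in J$ as a solution of $$S_n(\hat\theta,\hat\sigma^2)=\min_{(\theta,\sigma^2)\in J}S_n(\theta,\sigma^2).$$ Then $(\hat\theta,\hat\sigma^2)$ exists and $\hat\theta\hat\sigma^2\to\theta_0\sigma_0^2$ almost surely as $n\to\infty$. In particular, let $\sigma_1^2>0$ and $\theta_2>0$ be predetermined constants satisfying $\sigma_0^2\theta_0/\sigma_1^2\in[a,A]$ and $\sigma_0^2\theta_0/\theta_2\in[b,B]$. Define $\hat\theta_1\in[a,A]$ and $\hat\sigma_2^2\in[b,B]$ as solutions of $$S_n(\hat\theta_1,\sigma_1^2)=\min_{\theta\in[a,A]}S_n(\theta,\sigma_1^2),\qquad S_n(\theta_2,\hat\sigma_2^2)=\min_{\sigma^2\in[b,B]}S_n(\theta_2,\sigma^2).$$ Then $\hat\theta_1\to\theta_1:=\sigma_0^2\theta_0/\sigma_1^2$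 and $\hat\sigma_2^2\to\sigma_2^2:=\sigma_0^2\theta_0/\theta_2$ almost surely as $n\to\infty$.
   Context: The design points $s_i$ and spacings $\Delta_i$ form triangular arrays (dependence on $n$ is not written; designs need not be nested). The observations are $y_i=Y(s_i)$, $i=1,\dots,n$, from one fixed process $Y$. For $\theta>0$, let $R_\theta=[e^{-\theta|s_i-s_j|}]_{1\le i,j\le n}$. For each $i$, let $R_{\theta,-i}$ be $R_\theta$ with row and column $i$ removed, $r_{\theta,-i}$ the vector $(e^{-\theta|s_i-s_j|})_{j\ne i}$ and $y_{-i}=(y_j)_{j\neq i}$. Define the leave-one-out conditional mean and variance of $y_i$ given $y_{-i}$, computed as if $Y$ were a centered Gaussian process with covariance $\sigma^2e^{-\theta|t_1-t_2|}$: $$\hat Y_{\theta,-i}(s_i)=r_{\theta,-i}'R_{\theta,-i}^{-1}y_{-i},\qquad \hat\sigma^2_{\theta,\sigma^2,-i}(s_i)=\sigma^2\bigl(1-r_{\theta,-i}'R_{\theta,-i}^{-1}r_{\theta,-i}\bigr).$$ The logarithmic score is $$S_n(\theta,\sigma^2)=\sum_{i=1}^n\left[\log\bigl(\hat\sigma^2_{\theta,\sigma^2,-i}(s_i)\bigr)+\frac{(y_i-\hat Y_{\theta,-i}(s_i))^2}{\hat\sigma^2_{\theta,\sigma^2,-i}(s_i)}\right].$$ *)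

(* Defs.v *)
From HB Require Import structures.
From mathcomp Require Import all_boot all_order all_algebra.
From mathcomp Require Import all_classical all_reals all_analysis.

Set Implicit Arguments.
Unset Strict Implicit.
Unset Printing Implicit Defensive.

Import Order.TTheory GRing.Theory Num.Theory.
Import numFieldNormedType.Exports.

Local Open Scope classical_set_scope.
Local Open Scope ring_scope.

(* [normal_prob m s] takes the standard deviation [s], and is not a Dirac mass
   when [s = 0]; the degenerate Gaussian laws are therefore added by hand. *)
Definition gaussian_law (R : realType) (mu : set R -> \bar R) : Prop :=
  (exists m : R, forall V : set R, measurable V -> mu V = \d_m V) \/
  (exists m s : R, 0 < s /\
     forall V : set R, measurable V -> mu V = normal_prob m s V).

(* Finite-dimensional laws are Gaussian vectors in the sense that every linear
   combination of the coordinates has a (possibly degenerate) Gaussian law.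
   Only the variables [Y t] with [t] in the index set [I] are constrained. *)
Definition gaussian_process (R : realType) (d : measure_display)
    (T : measurableType d) (P : probability T R) (I : set R)
    (Y : R -> {RV P >-> R}) : Prop :=
  forall (k : nat) (t c : 'I_k -> R), (forall i, I (t i)) ->
    gaussian_law
      (fun V : set R => P ((fun w => \sum_(i < k) c i * Y (t i) w) @^-1` V)).

Definition centered_gaussian_process (R : realType) (d : measure_display)
    (T : measurableType d) (P : probability T R) (I : set R)
    (Y : R -> {RV P >-> R}) (K : R -> R -> R) : Prop :=
  [/\ gaussian_process I Y,
      forall t, I t -> ('E_P[Y t] = 0)%E &
      forall t1 t2, I t1 -> I t2 ->
        covariance P (Y t1) (Y t2) = (K t1 t2)%:E].

Definition exp_corr (R : realType) (theta t1 t2 : R) : R :=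
  expR (- theta * `|t1 - t2|).

(* Indices are 0-based: [s i] is the design point s_(i+1). *)
Definition is_design (R : realType) (n : nat) (s : 'I_n -> R) : Prop :=
  [/\ forall i : 'I_n, i = 0%N :> nat -> s i = 0,
      forall i : 'I_n, i.+1 = n -> s i = 1 &
      forall i j : 'I_n, (i < j)%N -> s i < s j].

(* Meaningful for [0 < i] only, since [ord_pred] is cyclic. *)
Definition spacing (R : realType) (n : nat) (s : 'I_n -> R) (i : 'I_n) : R :=
  s i - s (ord_pred i).

Definition max_spacing (R : realType) (n : nat) (s : 'I_n -> R) : R :=
  \big[Num.max/0]_(i < n | (0 < i)%N) spacing s i.

Section LeaveOneOut.
Variables (R : realType) (n : nat) (theta : R) (s : 'I_n -> R) (y : 'cV[R]_n).

Definition corr_mx : 'M[R]_n := \matrix_(i, j) exp_corr theta (s i) (s j).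

Definition loo_corr_mx (i : 'I_n) : 'M[R]_(n.-1) := row' i (col' i corr_mx).

Definition loo_corr_vec (i : 'I_n) : 'cV[R]_(n.-1) := row' i (col i corr_mx).

Definition loo_mean (i : 'I_n) : R :=
  ((loo_corr_vec i)^T *m invmx (loo_corr_mx i) *m row' i y) 0 0.

Definition loo_var (sigma2 : R) (i : 'I_n) : R :=
  sigma2 *
  (1 - ((loo_corr_vec i)^T *m invmx (loo_corr_mx i) *m loo_corr_vec i) 0 0).

Definition log_score (sigma2 : R) : R :=
  \sum_(i < n) (ln (loo_var sigma2 i)
                + (y i 0 - loo_mean i) ^+ 2 / loo_var sigma2 i).

End LeaveOneOut.

Definition minimizes (R : realType) (U : Type) (f : U -> R) (D : set U)
    (x : U) : Prop :=
  D x /\ forall x', D x' -> f x <= f x'.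

(* S_n(theta, sigma2), computed from the observations Y(s_i) at outcome w. *)
Definition score (R : realType) (d : measure_display) (T : measurableType d)
    (P : probability T R) (Y : R -> {RV P >-> R})
    (s : forall n : nat, 'I_n -> R) (n : nat) (w : T) (theta sigma2 : R) : R :=
  log_score theta (s n) (\col_i Y (s n i) w) sigma2.

(* Main.v *)
(* By the Markov property, the prediction of y_i from the other observations only
   involves the two neighbours of s_i, with explicit weights and variance. If l_i
   is the distance between these neighbours (or between an endpoint and its
   neighbour), so that the l_i sum to at most 2, then
     ln v_i(theta) = ln theta + ln c_i + O(l_i),
     e_i(theta)^2 / v_i(theta) = (theta0 / theta) e_i(theta0)^2 / v_i(theta0) + errors,
   uniformly in theta, where v_i is the prediction variance for sigma2 = 1, e_i is
   the prediction error and c_i depends on the design only. The errors add up to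
   eta X_n + N_n / eta for every eta in ]0, 1], with
   X_n = \sum_i e_i(theta0)^2 / v_i(theta0) and N_n a sum weighted by the l_i.
   Hence S_n / n is, up to a term free of the parameters,
   ln x + theta0 X_n / (n x) + o(1) at x = theta sigma2, provided that X_n / n tends
   to sigma02 and N_n / n to 0 almost surely.
   The standardized errors at theta0 are standard Gaussian, and uncorrelated when
   their indices have the same parity; so E (X_n / sigma02 - n)^4 = O(n^2), while
   E N_n^2 = O(1), and both limits follow from summability over n. Independence is
   never needed: the mixed moments are read off from the even moments of linear
   combinations. Finally (sqrt u - 1)^2 <= u - 1 - ln u at
   u = theta0 sigma02 / x turns almost minimality into convergence of x. *)
Require Import Defs.
From HB Require Import structures.
From mathcomp Require Import all_boot all_order all_algebra.
From mathcomp Require Import all_classical all_reals all_analysis.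
From mathcomp Require Import measurable_realfun ring lra zify.

Set Implicit Arguments.
Unset Strict Implicit.
Unset Printing Implicit Defensive.

Import Order.TTheory GRing.Theory Num.Theory.
Import numFieldNormedType.Exports.

Local Open Scope classical_set_scope.
Local Open Scope ring_scope.

(** * Leave-one-out prediction in the exponential model *)

(** The obstacle is that the gaps have no lower bound: neighbouring gaps h and k may have any ratio,
    and a prediction variance, of order hk/(h + k), can be arbitrarily small. Weights that are
    merely close to their limits k/(h + k) and h/(h + k) do not suffice; their squared errors must
    be of order hk, so that division by the variance leaves a multiple of l_i, which is summable.
    The cross term between the prediction error at theta0 and the change of prediction is still of
    order sqrt(l_i) only, and eta is there to split it between X_n and N_n. Fourth moments serve for
    X_n because the variance of X_n / n is of order 1/n, which is not summable, and designs of
    different sizes are unrelated. All randomness sits in the two limits for X_n and N_n: at an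
    outcome where they hold, the rest is deterministic and applies to any choice of minimizers. *)

(* [pred_weight p q] is the coefficient of the neighbour with correlation [p]
   when the other neighbour has correlation [q]; a missing neighbour is encoded
   by correlation [0], so that the first and last points need no special
   treatment. *)
Definition pred_weight (R : realType) (p q : R) : R :=
  p * (1 - q ^+ 2) / (1 - p ^+ 2 * q ^+ 2).

(** Conditional variance, for unit variance, given two neighbours with correlations p and q to the
    point and p q to each other; q = 0 gives the one-sided value 1 - p^2. *)
Definition pred_var (R : realType) (p q : R) : R :=
  (1 - p ^+ 2) * (1 - q ^+ 2) / (1 - p ^+ 2 * q ^+ 2).

Lemma pred_den_gt0 (R : realType) (p q : R) : 0 <= p < 1 -> 0 <= q < 1 ->
  0 < 1 - p ^+ 2 * q ^+ 2.
Proof.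
move=> /andP[p0 p1] /andP[q0 q1].
by rewrite -exprMn subr_gt0 expr_lt1 ?mulr_ge0 ?mulr_ilt1.
Qed.

Lemma pred_var_gt0 (R : realType) (p q : R) : 0 <= p < 1 -> 0 <= q < 1 ->
  0 < pred_var p q.
Proof.
move=> p01 q01; rewrite /pred_var divr_gt0 ?pred_den_gt0//.
case/andP: p01 => p0 p1; case/andP: q01 => q0 q1.
by apply: mulr_gt0; rewrite subr_gt0 expr_lt1.
Qed.

Section Neighbours.
Variables (R : realType) (n : nat) (s : 'I_n -> R).

Definition strictly_increasing := forall i j : 'I_n, (i < j)%N -> s i < s j.

Lemma ord_predE (i : 'I_n) : i != 0%N :> nat -> ord_pred i = i.-1 :> nat.
Proof.
move=> i0; have := ltn_ord i; rewrite /= => ilt.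
by rewrite [LHS]/= (_ : (i + n).-1 = i.-1 + n)%N ?modnDr ?modn_small//; lia.
Qed.

Lemma ordSE (i : 'I_n) : i.+1 != n -> ordS i = i.+1 :> nat.
Proof. by move=> i1; have := ltn_ord i => ?; rewrite [LHS]/= modn_small//; lia. Qed.

Hypothesis s_incr : strictly_increasing.

Lemma s_ord_pred (i : 'I_n) : i != 0%N :> nat -> s (ord_pred i) < s i.
Proof. by move=> i0; apply: s_incr; rewrite ord_predE//; lia. Qed.

Lemma s_ordS (i : 'I_n) : i.+1 != n -> s i < s (ordS i).
Proof. by move=> i1; apply: s_incr; rewrite ordSE//; lia. Qed.

Lemma s_homo (i j : 'I_n) : (i <= j)%N -> s i <= s j.
Proof.
by rewrite leq_eqVlt => /orP[/eqP/val_inj->//|/s_incr/ltW].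
Qed.

End Neighbours.

Section NeighbourPrediction.
Variables (R : realType) (n : nat) (theta : R) (s : 'I_n -> R).

Definition left_corr (i : 'I_n) : R :=
  if i == 0%N :> nat then 0 else expR (- (theta * (s i - s (ord_pred i)))).

Definition right_corr (i : 'I_n) : R :=
  if i.+1 == n then 0 else expR (- (theta * (s (ordS i) - s i))).

Definition left_weight i := pred_weight (left_corr i) (right_corr i).
Definition right_weight i := pred_weight (right_corr i) (left_corr i).
Definition nbr_var i := pred_var (left_corr i) (right_corr i).

(** At an endpoint [ord_pred] or [ordS] wraps around to the other end of the design; the
    corresponding weight is 0, so the stray value does not count. *)
Definition nbr_mean (y : 'I_n -> R) i :=
  left_weight i * y (ord_pred i) + right_weight i * y (ordS i).

Hypotheses (theta_gt0 : 0 < theta) (s_incr : strictly_increasing s).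

Lemma left_corr_ge0 i : 0 <= left_corr i.
Proof. by rewrite /left_corr; case: ifP => // _; exact: expR_ge0. Qed.

Lemma right_corr_ge0 i : 0 <= right_corr i.
Proof. by rewrite /right_corr; case: ifP => // _; exact: expR_ge0. Qed.

Lemma left_corr_lt1 i : left_corr i < 1.
Proof.
rewrite /left_corr; case: ifPn => // i0.
by rewrite expR_lt1 oppr_lt0 mulr_gt0// subr_gt0 s_ord_pred.
Qed.

Lemma right_corr_lt1 i : right_corr i < 1.
Proof.
rewrite /right_corr; case: ifPn => // i0.
by rewrite expR_lt1 oppr_lt0 mulr_gt0// subr_gt0 s_ordS.
Qed.

Lemma nbr_den_gt0 i : 0 < 1 - left_corr i ^+ 2 * right_corr i ^+ 2.
Proof.
by apply: pred_den_gt0; rewrite (left_corr_ge0, right_corr_ge0)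
  (left_corr_lt1, right_corr_lt1).
Qed.

Lemma nbr_var_gt0 i : 0 < nbr_var i.
Proof.
by apply: pred_var_gt0; rewrite (left_corr_ge0, right_corr_ge0)
  (left_corr_lt1, right_corr_lt1).
Qed.

Lemma exp_corr_ge (i j : 'I_n) : (i <= j)%N ->
  exp_corr theta (s i) (s j) = expR (- (theta * (s j - s i))).
Proof.
by move=> ij; rewrite /exp_corr distrC ger0_norm ?subr_ge0 ?s_homo// mulNr.
Qed.

Lemma exp_corrC (x y : R) : exp_corr theta x y = exp_corr theta y x.
Proof. by rewrite /exp_corr distrC. Qed.

Lemma exp_corrxx (x : R) : exp_corr theta x x = 1.
Proof. by rewrite /exp_corr subrr normr0 mulr0 expR0. Qed.

(* The Markov property: the correlation of [s i] with points on its left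
   factors through its left neighbour, and symmetrically. *)
Lemma exp_corr_left (i k : 'I_n) : (k < i)%N ->
  exp_corr theta (s i) (s k)
  = left_corr i * exp_corr theta (s (ord_pred i)) (s k).
Proof.
move=> ki; have i0 : i != 0%N :> nat by lia.
rewrite exp_corrC (@exp_corrC (s (ord_pred i))) !exp_corr_ge; last 2 first.
- by rewrite ord_predE//; lia.
- exact: ltnW.
by rewrite /left_corr (negbTE i0) -expRD; congr expR; ring.
Qed.

Lemma exp_corr_right (i k : 'I_n) : (i < k)%N ->
  exp_corr theta (s i) (s k) = right_corr i * exp_corr theta (s (ordS i)) (s k).
Proof.
move=> ik; have i1 : i.+1 != n by have := ltn_ord k; lia.
rewrite !exp_corr_ge; last 2 first.
- by rewrite ordSE//; lia.
- exact: ltnW.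
by rewrite /right_corr (negbTE i1) -expRD; congr expR; ring.
Qed.

Lemma left_corrE i : left_corr i = 0 \/
  left_corr i = exp_corr theta (s (ord_pred i)) (s i).
Proof.
rewrite /left_corr; case: ifPn => [_|i0]; [by left|right].
by rewrite exp_corr_ge// ord_predE//; lia.
Qed.

Lemma right_corrE i : right_corr i = 0 \/
  right_corr i = exp_corr theta (s (ordS i)) (s i).
Proof.
rewrite /right_corr; case: ifPn => [_|i0]; [by left|right].
by rewrite exp_corrC exp_corr_ge// ordSE//; lia.
Qed.

(** These are the normal equations of the prediction. For k left of i all correlations with [s k]
    factor through the left neighbour, which leaves an identity between the weights; k = i produces
    the variance. Invertibility, the leave-one-out formulas and the covariances of the errors all
    rest on this identity. *)
Lemma nbr_mean_corr i k :
  nbr_mean (fun j => exp_corr theta (s j) (s k)) i =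
  exp_corr theta (s i) (s k) - (k == i)%:R * nbr_var i.
Proof.
rewrite /nbr_mean /left_weight /right_weight /nbr_var /pred_weight /pred_var.
have D0 : 1 - left_corr i ^+ 2 * right_corr i ^+ 2 != 0.
  by rewrite gt_eqF// nbr_den_gt0.
have D1 : 1 - right_corr i ^+ 2 * left_corr i ^+ 2 != 0 by rewrite mulrC.
have [ki|ik|/val_inj ->] := ltngtP k i.
- have -> : (k == i) = false by apply/negP => /eqP ki'; rewrite ki' ltnn in ki.
  rewrite mulr0n mul0r subr0.
  rewrite (exp_corr_left ki).
  have [->|->] : right_corr i = 0 \/ exp_corr theta (s (ordS i)) (s k) =
      right_corr i * left_corr i * exp_corr theta (s (ord_pred i)) (s k).
    have [in_|in_] := eqVneq i.+1 n; first by left; rewrite /right_corr in_ eqxx.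
    right; rewrite exp_corrC exp_corr_ge ?ordSE//; last by lia.
    rewrite exp_corrC exp_corr_ge; last by rewrite ord_predE; lia.
    rewrite /right_corr /left_corr (negbTE in_) ifF; last by lia.
    by rewrite -!expRD; congr expR; ring.
  + by field.
  + by field; rewrite exprMn.
- have -> : (k == i) = false by apply/negP => /eqP ki'; rewrite ki' ltnn in ik.
  rewrite mulr0n mul0r subr0.
  rewrite (exp_corr_right ik).
  have [->|->] : left_corr i = 0 \/ exp_corr theta (s (ord_pred i)) (s k) =
      right_corr i * left_corr i * exp_corr theta (s (ordS i)) (s k).
    have [i0|i0] := eqVneq (i : nat) 0%N; first by left; rewrite /left_corr i0.
    right; have i1 : i.+1 != n by have := ltn_ord k; lia.
    rewrite !exp_corr_ge ?ord_predE ?ordSE//; [|by lia..].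
    rewrite /right_corr /left_corr (negbTE i0) (negbTE i1).
    by rewrite -!expRD; congr expR; ring.
  + by field.
  + by field; rewrite exprMn.
- rewrite eqxx exp_corrxx mulr1n mul1r.
  move: D0 D1; have [-> | <-] := left_corrE i; have [-> | <-] := right_corrE i;
  by move=> D0 D1; field; rewrite ?exprMn.
Qed.

(* Row [i] of [B] holds the coefficients of the prediction error at [s i], so
   [B *m corr_mx] is diagonal with the prediction variances on the diagonal. *)
Lemma corr_mx_unit : corr_mx theta s \in unitmx.
Proof.
pose B : 'M[R]_n := \matrix_(i, j) ((j == i)%:R
  - (left_weight i * (j == ord_pred i)%:R + right_weight i * (j == ordS i)%:R)).
suff : B *m corr_mx theta s = diag_mx (\row_i nbr_var i).
  move=> BK; have : B *m corr_mx theta s \in unitmx.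
    rewrite BK unitmxE det_diag unitfE; apply/prodf_neq0 => i _.
    by rewrite mxE gt_eqF// nbr_var_gt0.
  by rewrite unitmx_mul => /andP[].
have pick (i : 'I_n) (f : 'I_n -> R) : \sum_j (j == i)%:R * f j = f i.
  rewrite (bigD1 i)//= eqxx mul1r big1 ?addr0// => j /negbTE ->.
  by rewrite mul0r.
apply/matrixP => i k; rewrite !mxE.
under eq_bigr do rewrite !mxE mulrBl mulrDl
    -(mulrA (left_weight i)) -(mulrA (right_weight i)).
rewrite sumrB big_split/= -!mulr_sumr !pick.
have := nbr_mean_corr i k; rewrite /nbr_mean => ->.
rewrite opprB addrC subrK eq_sym.
by have [->|] := eqVneq i k; rewrite ?mul1r ?mul0r.
Qed.

End NeighbourPrediction.

(** Deleting index i means summing over [lift i]. With at least two points the cyclic neighbours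
    differ from i, so neither indicator is lost. *)
Lemma sum_lift_nbr (R : realType) n (theta : R) (s : 'I_n.+1 -> R)
    (i : 'I_n.+1) (f : 'I_n.+1 -> R) : (0 < n)%N ->
  \sum_(j < n) (left_weight theta s i * (lift i j == ord_pred i)%:R
    + right_weight theta s i * (lift i j == ordS i)%:R) * f (lift i j)
  = nbr_mean theta s f i.
Proof.
move=> n0; have pick (k : 'I_n.+1) : k != i ->
    \sum_(j < n) (lift i j == k)%:R * f (lift i j) = f k.
  move=> ki; transitivity (\sum_j (j == k)%:R * f j).
    by rewrite [RHS](bigD1_ord i)//= eq_sym (negbTE ki) mul0r add0r.
  rewrite (bigD1 k)//= eqxx mul1r big1 ?addr0// => j /negbTE ->.
  by rewrite mul0r.
under eq_bigr do rewrite mulrDl -(mulrA (left_weight _ _ i))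
    -(mulrA (right_weight _ _ i)).
rewrite big_split/= -!mulr_sumr !pick//.
- apply: contraTneq n0 => /(congr1 val)/=.
  have [i1|i1] := eqVneq i.+1 n.+1; first by rewrite i1 modnn; lia.
  by rewrite modn_small; have := ltn_ord i; lia.
- apply: contraTneq n0 => /(congr1 val)/=; rewrite addnS/=.
  have [->|i0] := eqVneq (i : nat) 0%N; first by rewrite add0n modn_small//; lia.
  by rewrite (_ : i + n = i.-1 + n.+1)%N ?modnDr ?modn_small; have := ltn_ord i; lia.
Qed.

Section LeaveOneOutPrediction.
Variables (R : realType) (n : nat) (theta : R) (s : 'I_n -> R).
Hypotheses (n_ge2 : (2 <= n)%N) (theta_gt0 : 0 < theta).
Hypothesis (s_incr : strictly_increasing s).

(** No inverse is computed: by [nbr_mean_corr] at indices k != i, the row u of neighbour weights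
    satisfies u K = r for the reduced matrix K, hence r K^-1 = u. *)
Lemma loo_solve (i : 'I_n) (y : 'cV[R]_n) :
  ((loo_corr_vec theta s i)^T *m invmx (loo_corr_mx theta s i) *m row' i y) 0 0
  = nbr_mean theta s (y^~ 0) i.
Proof.
case: n n_ge2 s s_incr i y => [//|m] m1 t t_incr i y.
pose u : 'cV[R]_m.+1.-1 := \col_j (left_weight theta t i * (lift i j == ord_pred i)%:R
    + right_weight theta t i * (lift i j == ordS i)%:R).
have K_unit : loo_corr_mx theta t i \in unitmx.
  (* The reduced matrix is the correlation matrix of the design without its i-th point, which is
     still increasing. *)
  rewrite (_ : loo_corr_mx theta t i = corr_mx theta (t \o lift i)); last first.
    by apply/matrixP => j k; rewrite !mxE.
  apply: corr_mx_unit => // j k jk; apply: t_incr => /=.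
  by rewrite ltnNge leq_bump2 -ltnNge.
have -> : (loo_corr_vec theta t i)^T = u^T *m loo_corr_mx theta t i.
  apply/matrixP => j k; rewrite !mxE ord1.
  under eq_bigr do rewrite !mxE.
  rewrite (@sum_lift_nbr _ _ _ _ _ (fun l => exp_corr theta (t l) (t (lift i k))))//.
  rewrite nbr_mean_corr// (negbTE (_ : lift i k != i)) 1?eq_sym ?neq_lift//.
  by rewrite mul0r subr0 exp_corrC.
rewrite mulmxK// mxE; under eq_bigr do rewrite !mxE.
by rewrite (@sum_lift_nbr _ _ _ _ _ (y^~ 0)).
Qed.

Lemma loo_meanE (y : 'cV[R]_n) (i : 'I_n) :
  loo_mean theta s y i = nbr_mean theta s (y^~ 0) i.
Proof. exact: loo_solve. Qed.

Lemma loo_varE (sigma2 : R) (i : 'I_n) :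
  loo_var theta s sigma2 i = sigma2 * nbr_var theta s i.
Proof.
rewrite /loo_var /loo_corr_vec loo_solve; congr (_ * _).
have -> : (col i (corr_mx theta s))^~ 0 = (fun j => exp_corr theta (s j) (s i)).
  by apply/funext => j; rewrite !mxE.
by rewrite nbr_mean_corr// eqxx exp_corrxx mul1r subKr.
Qed.

Definition std_err2 (y : 'I_n -> R) (i : 'I_n) : R :=
  (y i - nbr_mean theta s y i) ^+ 2 / nbr_var theta s i.

Lemma log_scoreE (y : 'cV[R]_n) (sigma2 : R) :
  log_score theta s y sigma2 =
  \sum_(i < n) (ln (sigma2 * nbr_var theta s i)
                + std_err2 (y^~ 0) i / sigma2).
Proof.
apply: eq_bigr => i _; rewrite loo_varE loo_meanE /std_err2.
by congr (_ + _); rewrite invfM (mulrC sigma2^-1) mulrA.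
Qed.

End LeaveOneOutPrediction.

(** * Uniform expansion of the score *)

Section ExponentialBounds.
Variable R : realType.
Implicit Types x y : R.

Lemma onem_expRN_le x : 1 - expR (- x) <= x.
Proof. by have := expR_ge1Dx (- x); lra. Qed.

Lemma onem_expRN_ge x : x * expR (- x) <= 1 - expR (- x).
Proof.
have /(ler_wpM2r (expR_ge0 (- x))) := expR_ge1Dx x.
by rewrite -expRD subrr expR0 mulrDl mul1r; lra.
Qed.

Lemma expR_sub1_le x : expR x - 1 <= x * expR x.
Proof.
have /(ler_wpM2r (expR_ge0 x)) := onem_expRN_le x.
by rewrite mulrBl -expRD addNr expR0 mul1r.
Qed.

Lemma onem_expRN_gt0 x : 0 < x -> 0 < 1 - expR (- x).
Proof. by move=> x0; rewrite subr_gt0 expR_lt1 oppr_lt0. Qed.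

(** From x exp(-x) <= 1 - exp(-x) <= x: linearizing inside the logarithm costs at most x, which is
    why later remainders are proportional to gaps. *)
Lemma ln_onem_expRN x : 0 < x -> ln x - x <= ln (1 - expR (- x)) <= ln x.
Proof.
move=> x0; apply/andP; split; last first.
  by rewrite ler_ln ?posrE ?onem_expRN_gt0// onem_expRN_le.
rewrite -[X in _ - X]expRK -ln_div ?posrE ?expR_gt0//.
rewrite ler_ln ?posrE ?onem_expRN_gt0// ?divr_gt0 ?expR_gt0//.
by rewrite -expRN onem_expRN_ge.
Qed.

End ExponentialBounds.

Section PredictionBounds.
Variables (R : realType) (M theta h k : R).
Hypotheses (theta_gt0 : 0 < theta) (theta_le : theta <= M).
Hypotheses (h_gt0 : 0 < h) (k_gt0 : 0 < k) (hk_le1 : h + k <= 1).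

Let p := expR (- (theta * h)).
Let q := expR (- (theta * k)).

Let p2E : p ^+ 2 = expR (- (2 * theta * h)).
Proof. by rewrite -expRM_natl; congr expR; ring. Qed.

Let q2E : q ^+ 2 = expR (- (2 * theta * k)).
Proof. by rewrite -expRM_natl; congr expR; ring. Qed.

Let pq2E : p ^+ 2 * q ^+ 2 = expR (- (2 * theta * (h + k))).
Proof. by rewrite p2E q2E -expRD; congr expR; ring. Qed.

(** The variance is a quotient of three factors 1 - exp(-x), with x = 2 theta h, 2 theta k and 2
    theta (h + k). Linearizing each gives theta * 2hk/(h + k), and the errors on either side add up
    to at most 2 theta (h + k). *)
Lemma ln_pred_var_bound :
  `|ln (pred_var p q) - ln theta - ln (2 * h * k / (h + k))|
  <= 2 * theta * (h + k).
Proof.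
have th0 : 0 < 2 * theta * h by rewrite !mulr_gt0.
have tk0 : 0 < 2 * theta * k by rewrite !mulr_gt0.
have hk0 : 0 < h + k by rewrite addr_gt0.
have tl0 : 0 < 2 * theta * (h + k) by rewrite !mulr_gt0.
rewrite /pred_var pq2E p2E q2E.
rewrite !ln_div ?posrE ?mulr_gt0 ?onem_expRN_gt0//.
have := ln_onem_expRN th0; have := ln_onem_expRN tk0; have := ln_onem_expRN tl0.
rewrite !lnM ?posrE ?mulr_gt0 ?onem_expRN_gt0// => /andP[? ?] /andP[? ?] /andP[? ?].
by rewrite ler_norml; apply/andP; split; lra.
Qed.

(** The deficit equals (1 - p)(1 - q)/(1 + pq), hence is of second order; an estimate for one weight
    can thus be transferred to the other. *)
Lemma pred_weight_sum : 0 <= 1 - (pred_weight p q + pred_weight q p) <= M ^+ 2 * (h * k).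
Proof.
have p0 : 0 < p by exact: expR_gt0.
have q0 : 0 < q by exact: expR_gt0.
have p1 : p < 1 by rewrite expR_lt1 oppr_lt0 mulr_gt0.
have q1 : q < 1 by rewrite expR_lt1 oppr_lt0 mulr_gt0.
have pq0 : 0 < p * q by rewrite mulr_gt0.
have pq1 : p * q < 1 by rewrite mulr_ilt1// ltW.
have -> : 1 - (pred_weight p q + pred_weight q p) = (1 - p) * (1 - q) / (1 + p * q).
  rewrite /pred_weight; field.
  rewrite !gt_eqF//; last by lra.
  by rewrite subr_gt0 expr_lt1 ?(mulrC q)// ltW.
apply/andP; split.
  by rewrite divr_ge0 ?mulr_ge0//; lra.
rewrite ler_pdivrMr; last lra.
have tp : 1 - p <= theta * h by exact: onem_expRN_le.
have tq : 1 - q <= theta * k by exact: onem_expRN_le.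
have : (1 - p) * (1 - q) <= (M * h) * (M * k).
  apply: ler_pM; [lra|lra| |].
    by apply: (le_trans tp); rewrite ler_pM2r.
  by apply: (le_trans tq); rewrite ler_pM2r.
have : 0 <= M ^+ 2 * (h * k * (p * q)).
  by rewrite mulr_ge0 ?sqr_ge0// ltW// !mulr_gt0.
by lra.
Qed.

(** The weight lies between k/(h + k) times 1 - 2 theta (h + k) and k/(h + k) times exp(2 theta (h +
    k)): a relative error of order h + k, hence an absolute one of order k. *)
Lemma pred_weight_bound :
  `|pred_weight p q - k / (h + k)| <= 2 * M * expR (2 * M) * k.
Proof.
have M0 : 0 < M by exact: lt_le_trans theta_le.
have p0 : 0 < p by exact: expR_gt0.
have q0 : 0 < q by exact: expR_gt0.
have l0 : 0 < h + k by rewrite addr_gt0.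
set l := h + k in l0 *.
have tl0 : 0 < 2 * theta * l by rewrite !mulr_gt0.
have tk0 : 0 < 2 * theta * k by rewrite !mulr_gt0.
have E0 : 0 < 1 - expR (- (2 * theta * l)) by exact: onem_expRN_gt0.
have eM : expR (2 * theta * l) <= expR (2 * M).
  rewrite ler_expR -mulrA ler_pM2l//.
  by apply: le_trans (theta_le); rewrite ger_pMr.
have eM1 : 1 <= expR (2 * M) by rewrite -[leLHS]expR0 ler_expR mulr_ge0// ltW.
rewrite ler_norml /pred_weight pq2E -/l q2E; apply/andP; split.
- have : k / l * (1 - 2 * theta * l) <=
      p * (1 - expR (- (2 * theta * k))) / (1 - expR (- (2 * theta * l))).
    rewrite ler_pdivlMr//.
    have a1 : p * (2 * theta * k * expR (- (2 * theta * k))) <=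
        p * (1 - expR (- (2 * theta * k))).
      by rewrite ler_pM2l// onem_expRN_ge.
    apply: le_trans a1.
    have a2 : 1 - 2 * theta * l <= p * expR (- (2 * theta * k)).
      rewrite /p -expRD; apply: le_trans (expR_ge1Dx _).
      have : 0 < theta * h by rewrite mulr_gt0.
      by rewrite /l; lra.
    have a3 := onem_expRN_le (2 * theta * l).
    have kl0 : 0 < k / l by rewrite divr_gt0.
    have [neg|pos] := leP (1 - 2 * theta * l) 0.
      apply: (@le_trans _ _ 0); last by rewrite !mulr_ge0// ?expR_ge0// ltW.
      by rewrite pmulr_lle0// pmulr_rle0.
    have a4 : (1 - 2 * theta * l) * (1 - expR (- (2 * theta * l)))
        <= p * expR (- (2 * theta * k)) * (2 * theta * l).
      by rewrite ler_pM// ltW.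
    rewrite -(mulrA (k / l)); apply: (le_trans (ler_wpM2l (ltW kl0) a4)).
    by rewrite le_eqVlt; apply/orP; left; apply/eqP; field; rewrite gt_eqF.
  rewrite mulrBr mulr1 (_ : k / l * (2 * theta * l) = 2 * theta * k); last first.
    by field; rewrite gt_eqF.
  have : 2 * theta * k <= 2 * M * expR (2 * M) * k.
    have te : theta <= M * expR (2 * M).
      by apply: (le_trans theta_le); rewrite ler_peMr// ltW.
    by have := ler_wpM2r (ltW k_gt0) te; lra.
  by lra.
- have : p * (1 - expR (- (2 * theta * k))) / (1 - expR (- (2 * theta * l)))
      <= k / l * expR (2 * theta * l).
    rewrite ler_pdivrMr//.
    have p1 : p <= 1 by rewrite -[leRHS]expR0 ler_expR oppr_le0 mulr_ge0// ltW.
    apply: (@le_trans _ _ (2 * theta * k)).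
      apply: le_trans (onem_expRN_le _); rewrite ger_pMl//.
      by rewrite onem_expRN_gt0.
    rewrite -(mulrA (k / l)) (mulrBr (expR _)) mulr1 -expRD subrr expR0.
    have : 2 * theta * l <= expR (2 * theta * l) - 1.
      by have := expR_ge1Dx (2 * theta * l); lra.
    have kl0 : 0 <= k / l by rewrite divr_ge0// ltW.
    move=> /(ler_wpM2l kl0); apply: le_trans.
    by rewrite le_eqVlt; apply/orP; left; apply/eqP; field; rewrite gt_eqF.
  have : k / l * (expR (2 * theta * l) - 1) <= 2 * M * expR (2 * M) * k.
    have kl0 : 0 <= k / l by rewrite divr_ge0// ltW.
    have := ler_wpM2l kl0 (expR_sub1_le (2 * theta * l)).
    move=> /le_trans; apply.
    rewrite (_ : k / l * (2 * theta * l * expR (2 * theta * l)) = 2 * theta * expR (2 * theta * l) * k); last first.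
      by field; rewrite gt_eqF.
    rewrite ler_pM2r//; apply: ler_pM => //; rewrite ?expR_ge0 ?mulr_ge0 ?ler_pM2l//.
    exact: ltW.
  by rewrite mulrBr mulr1; lra.
Qed.

End PredictionBounds.

(** The first term comes from [pred_weight_bound], the second from the deficit in [pred_weight_sum],
    paid when one weight is estimated through the other. *)
Definition weight_cst (R : realType) (M : R) : R :=
  2 * M * expR (2 * M) + M ^+ 2.

Lemma weight_cst_gt0 (R : realType) (M : R) : 0 < M -> 0 < weight_cst M.
Proof.
by move=> M0; rewrite addr_gt0 ?exprn_gt0// mulr_gt0 ?expR_gt0// mulr_gt0.
Qed.

(* The weight of a neighbour is within O(k) of its limit directly, and within
   O(h) through the complementary weight; the geometric mean is what matters. *)
Lemma pred_weight_sqr_bound (R : realType) (M theta h k : R) :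
  0 < theta -> theta <= M -> 0 < h -> 0 < k -> h + k <= 1 ->
  (pred_weight (expR (- (theta * h))) (expR (- (theta * k))) - k / (h + k)) ^+ 2
  <= weight_cst M ^+ 2 * (h * k).
Proof.
move=> t0 tM h0 k0 hk1.
have M0 : 0 < M by exact: lt_le_trans tM.
have := pred_weight_sum t0 tM h0 k0.
have := pred_weight_bound t0 tM h0 k0 hk1.
have := @pred_weight_bound _ M theta k h t0 tM k0 h0; rewrite (addrC k) => /(_ hk1).
set w' := pred_weight _ _; set w := pred_weight _ _.
have -> : h / (h + k) = 1 - k / (h + k) by field; rewrite gt_eqF ?addr_gt0.
set K := k / (h + k); set C := 2 * M * expR (2 * M); set B := M ^+ 2.
have B0 : 0 < B by rewrite exprn_gt0.
have C0 : 0 < C by rewrite /C mulr_gt0 ?expR_gt0// mulr_gt0.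
move=> w'h wk /andP[s0 s1]; rewrite /weight_cst -/C -/B.
have hk : h * k <= h by rewrite ger_pMr//; lra.
have Bhk := ler_wpM2l (ltW B0) hk.
have : `|w - K| <= (C + B) * k.
  by apply: (le_trans wk); rewrite ler_pM2r//; lra.
have : `|w - K| <= (C + B) * h.
  by move: w'h; rewrite !ler_norml => /andP[? ?]; apply/andP; split; lra.
rewrite -(real_normK (num_real _)); move: (normr_ge0 (w - K)).
set D := `|_| => D0 Dh Dk; rewrite (_ : _ * (h * k) = (C + B) * h * ((C + B) * k)).
  exact: ler_pM.
by ring.
Qed.

(** * Gaps of a design and the uniform estimates they control *)

Section Gaps.
Variables (R : realType) (n : nat) (s : 'I_n -> R).

Definition left_gap (i : 'I_n) : R :=
  if i == 0%N :> nat then 0 else s i - s (ord_pred i).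

Definition right_gap (i : 'I_n) : R :=
  if i.+1 == n then 0 else s (ordS i) - s i.

Definition nbr_len i := left_gap i + right_gap i.

(* [theta * nbr_scale i] is the first-order expansion of [nbr_var theta s i]. *)
Definition nbr_scale (i : 'I_n) : R :=
  if i == 0%N :> nat then 2 * right_gap i else
  if i.+1 == n then 2 * left_gap i else
  2 * left_gap i * right_gap i / nbr_len i.

End Gaps.

Section GapSums.
Variables (R : realType) (m : nat) (s : 'I_m.+1 -> R).

Let u k := s (inord k).

Let telescope : \sum_(i < m) (u i.+1 - u i) = s ord_max - s ord0.
Proof.
rewrite -(big_mkord xpredT (fun i => u i.+1 - u i)) telescope_sumr// /u.
by congr (s _ - s _); apply/val_inj; rewrite /= inordK.
Qed.

Lemma sum_right_gap : \sum_i right_gap s i = s ord_max - s ord0.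
Proof.
rewrite -telescope big_ord_recr/= [X in _ + X]/right_gap eqxx addr0.
apply: eq_bigr => i _; rewrite /right_gap ifF; last by move: (ltn_ord i) => /=; lia.
by congr (s _ - s _); apply/val_inj => /=; rewrite inordK ?modn_small//;
  move: (ltn_ord i) => /=; lia.
Qed.

Lemma sum_left_gap : \sum_i left_gap s i = s ord_max - s ord0.
Proof.
rewrite -telescope big_ord_recl/= [X in X + _]/left_gap eqxx add0r.
apply: eq_bigr => i _; rewrite /left_gap/=.
congr (s _ - s _); apply/val_inj; rewrite /= ?inordK ?add0n ?modnDr ?modn_small//;
  by move: (ltn_ord i) => /=; lia.
Qed.

End GapSums.

Section Designs.
Variables (R : realType) (n : nat) (s : 'I_n -> R).
Hypotheses (n_ge2 : (2 <= n)%N) (s_design : is_design s).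

Local Notation left_gap := (left_gap s).
Local Notation right_gap := (right_gap s).
Local Notation nbr_len := (nbr_len s).

Lemma design_incr : strictly_increasing s.
Proof. by case: s_design. Qed.

Lemma design_itv i : 0 <= s i <= 1.
Proof.
case: n n_ge2 s s_design i => [//|m] m1 t [t0 t1 t_incr] i.
rewrite -(t0 ord0)// -(t1 ord_max)//.
by rewrite !s_homo//= -ltnS.
Qed.

Lemma left_gap_gt0 (i : 'I_n) : i != 0%N :> nat -> 0 < left_gap i.
Proof.
by move=> i0; rewrite /left_gap (negbTE i0) subr_gt0 s_ord_pred//; exact: design_incr.
Qed.

Lemma right_gap_gt0 (i : 'I_n) : i.+1 != n -> 0 < right_gap i.
Proof.
by move=> i0; rewrite /right_gap (negbTE i0) subr_gt0 s_ordS//; exact: design_incr.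
Qed.

Lemma left_gap_ge0 i : 0 <= left_gap i.
Proof.
have [i0|/left_gap_gt0/ltW//] := eqVneq (i : nat) 0%N.
by rewrite /left_gap i0.
Qed.

Lemma right_gap_ge0 i : 0 <= right_gap i.
Proof.
have [i0|/right_gap_gt0/ltW//] := eqVneq i.+1 n.
by rewrite /right_gap i0 eqxx.
Qed.

Lemma nbr_len_le1 i : nbr_len i <= 1.
Proof.
have := design_itv (ordS i); have := design_itv (ord_pred i); have := design_itv i.
move=> /andP[? ?] /andP[? ?] /andP[? ?].
by rewrite /nbr_len /left_gap /right_gap; case: ifP; case: ifP => _ _; lra.
Qed.

Lemma nbr_len_ge0 i : 0 <= nbr_len i.
Proof. by rewrite addr_ge0 ?left_gap_ge0 ?right_gap_ge0. Qed.

Lemma sum_nbr_len : \sum_i nbr_len i <= 2.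
Proof.
case: n n_ge2 s s_design => [//|m] m1 t [t0 t1 t_incr].
by rewrite big_split/= sum_right_gap sum_left_gap (t0 ord0)// (t1 ord_max)//; lra.
Qed.

Lemma nbr_scale_gt0 i : 0 < nbr_scale s i.
Proof.
rewrite /nbr_scale; case: eqVneq => [i0|i0].
  by rewrite mulr_gt0// right_gap_gt0//; lia.
case: eqVneq => [i1|i1]; first by rewrite mulr_gt0// left_gap_gt0.
by rewrite divr_gt0 ?addr_gt0 ?mulr_gt0 ?left_gap_gt0 ?right_gap_gt0.
Qed.

Lemma left_corr_gap theta (i : 'I_n) : i != 0%N :> nat ->
  left_corr theta s i = expR (- (theta * left_gap i)).
Proof. by move=> i0; rewrite /left_corr /left_gap (negbTE i0). Qed.

Lemma right_corr_gap theta (i : 'I_n) : i.+1 != n ->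
  right_corr theta s i = expR (- (theta * right_gap i)).
Proof. by move=> i0; rewrite /right_corr /right_gap (negbTE i0). Qed.

Lemma ln_nbr_var_bound theta i : 0 < theta ->
  `|ln (nbr_var theta s i) - ln theta - ln (nbr_scale s i)|
  <= 2 * theta * nbr_len i.
Proof.
move=> t0.
(* At an endpoint the variance is 1 - exp(-2 theta h), whence the value 2h of [nbr_scale] there. *)
have one_gap (h : R) : 0 < h ->
    `|ln (1 - expR (- (theta * h)) ^+ 2) - ln theta - ln (2 * h)| <= 2 * theta * h.
  move=> h0; have -> : expR (- (theta * h)) ^+ 2 = expR (- (2 * theta * h)).
    by rewrite -expRM_natl; congr expR; ring.
  have := ln_onem_expRN (_ : 0 < 2 * theta * h); rewrite !mulr_gt0// => /(_ isT).
  rewrite !lnM ?posrE ?mulr_gt0// => /andP[? ?].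
  by rewrite ler_norml; apply/andP; split; lra.
rewrite /nbr_var /nbr_scale /nbr_len; case: eqVneq => [i0|i0].
  rewrite /left_corr i0 eqxx right_corr_gap; last by lia.
  rewrite /pred_var expr0n/= subr0 mul1r mul0r subr0 divr1 /left_gap i0 eqxx add0r.
  by apply: one_gap; rewrite right_gap_gt0//; lia.
rewrite left_corr_gap//; case: eqVneq => [i1|i1].
  rewrite /right_corr i1 eqxx.
  rewrite /pred_var expr0n/= subr0 mulr1 mulr0 subr0 divr1 /right_gap i1 eqxx addr0.
  by apply: one_gap; rewrite left_gap_gt0.
rewrite right_corr_gap//.
by apply: ln_pred_var_bound; rewrite ?left_gap_gt0 ?right_gap_gt0.
Qed.

(** The limits u and v depend on the design only, so weights at two parameters are compared through
    them. For an interior point [nbr_len s i * nbr_scale s i] is 2hk; at an endpoint the limits are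
    1 for the only neighbour and 0 for the missing one. *)
Lemma nbr_weight_limit (M : R) i : 0 < M -> exists u v : R,
  forall theta, 0 < theta <= M ->
    (left_weight theta s i - u) ^+ 2 <=
      weight_cst M ^+ 2 * (nbr_len i * nbr_scale s i) /\
    (right_weight theta s i - v) ^+ 2 <=
      weight_cst M ^+ 2 * (nbr_len i * nbr_scale s i).
Proof.
move=> M0; have C0 := weight_cst_gt0 M0.
have one_gap (h theta : R) : 0 < h -> 0 < theta <= M ->
    (expR (- (theta * h)) - 1) ^+ 2 <= weight_cst M ^+ 2 * (h * (2 * h)).
  move=> h0 /andP[t0 tM].
  have e1 : expR (- (theta * h)) <= 1.
    by rewrite -[leRHS]expR0 ler_expR oppr_le0 mulr_ge0// ltW.
  have e2 := onem_expRN_le (theta * h).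
  have e3 : theta <= weight_cst M.
    rewrite /weight_cst; have : 0 <= M ^+ 2 by rewrite sqr_ge0.
    have : M * 1 <= M * expR (2 * M).
      by rewrite ler_pM2l// -[leLHS]expR0 ler_expR mulr_ge0// ltW.
    by lra.
  have e4 := ler_wpM2r (ltW h0) e3.
  have : (1 - expR (- (theta * h))) ^+ 2 <= (weight_cst M * h) ^+ 2.
    by rewrite lerXn2r ?nnegrE//; [lra|rewrite mulr_ge0// ltW|lra].
  have : 0 <= (weight_cst M * h) ^+ 2 by exact: sqr_ge0.
  by lra.
have nonneg : 0 <= weight_cst M ^+ 2 * (nbr_len i * nbr_scale s i).
  by rewrite !mulr_ge0 ?sqr_ge0 ?nbr_len_ge0// ltW// nbr_scale_gt0.
rewrite /left_weight /right_weight.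
have [i0|i0] := eqVneq (i : nat) 0%N.
  exists 0, 1 => theta tM; have i1 : i.+1 != n by lia.
  rewrite (_ : left_corr theta s i = 0); last by rewrite /left_corr i0.
  rewrite /pred_weight !mul0r subrr !expr0n/= mulr0 !subr0 mulr1 divr1.
  split => //; rewrite right_corr_gap//.
  rewrite /nbr_scale i0 /= (_ : nbr_len i = right_gap i); last first.
    by rewrite /nbr_len /left_gap i0 add0r.
  exact/one_gap/tM/right_gap_gt0.
have [i1|i1] := eqVneq i.+1 n.
  exists 1, 0 => theta tM.
  rewrite (_ : right_corr theta s i = 0); last by rewrite /right_corr i1 eqxx.
  rewrite /pred_weight !mul0r subrr !expr0n/= mulr0 !subr0 mulr1 divr1.
  split => //; rewrite left_corr_gap//.
  rewrite /nbr_scale (negbTE i0) i1 eqxx (_ : nbr_len i = left_gap i); last first.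
    by rewrite /nbr_len /right_gap i1 eqxx addr0.
  exact/one_gap/tM/left_gap_gt0.
exists (right_gap i / nbr_len i), (left_gap i / nbr_len i) => theta /andP[t0 tM].
rewrite left_corr_gap// right_corr_gap// /nbr_scale (negbTE i0) (negbTE i1).
have h0 := left_gap_gt0 i0; have k0 := right_gap_gt0 i1; have l1 := nbr_len_le1 i.
have -> : nbr_len i * (2 * left_gap i * right_gap i / nbr_len i)
    = 2 * (left_gap i * right_gap i).
  by field; rewrite gt_eqF// addr_gt0.
have hk0 : 0 <= weight_cst M ^+ 2 * (left_gap i * right_gap i).
  by rewrite mulr_ge0 ?sqr_ge0// ltW// mulr_gt0.
have := pred_weight_sqr_bound t0 tM h0 k0 l1.
have := @pred_weight_sqr_bound _ M theta _ _ t0 tM k0 h0.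
rewrite (addrC (right_gap i)) => /(_ l1).
by rewrite -/(nbr_len i) => ? ?; split; lra.
Qed.

End Designs.

Lemma ler_sqrD (R : realType) (x y : R) : (x + y) ^+ 2 <= 2 * (x ^+ 2 + y ^+ 2).
Proof. by have := sqr_ge0 (x - y); rewrite sqrrB sqrrD; lra. Qed.

Definition nbr_sqr (R : realType) n (y : 'I_n -> R) (i : 'I_n) : R :=
  y (ord_pred i) ^+ 2 + y (ordS i) ^+ 2.

Lemma nbr_sqr_ge0 (R : realType) n (y : 'I_n -> R) i : 0 <= nbr_sqr y i.
Proof. by rewrite addr_ge0 ?sqr_ge0. Qed.

Section UniformExpansion.
Variables (R : realType) (n : nat) (s : 'I_n -> R) (M theta0 : R).
Hypotheses (n_ge2 : (2 <= n)%N) (s_design : is_design s).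
Hypothesis theta0_itv : 0 < theta0 <= M.

Let theta0_gt0 : 0 < theta0. Proof. by case/andP: theta0_itv. Qed.
Let M_gt0 : 0 < M. Proof. by case/andP: theta0_itv => /lt_le_trans; apply. Qed.

Lemma nbr_var_ge i :
  theta0 * expR (- (2 * M)) * nbr_scale s i <= nbr_var theta0 s i.
Proof.
have v0 : 0 < nbr_var theta0 s i by apply: nbr_var_gt0 => //; exact: design_incr.
have c0 := nbr_scale_gt0 n_ge2 s_design i.
have := ln_nbr_var_bound n_ge2 s_design i theta0_gt0.
rewrite ler_norml => /andP[+ _].
have : 2 * theta0 * nbr_len s i <= 2 * M.
  rewrite -mulrA ler_pM2l//; case/andP: theta0_itv => _ t0M.
  apply: le_trans t0M; rewrite ger_pMr//; exact: nbr_len_le1.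
move: (nbr_var theta0 s i) v0 => V v0 h1 h2.
rewrite -ler_ln ?posrE ?mulr_gt0 ?expR_gt0//.
by rewrite !lnM ?posrE ?mulr_gt0 ?expR_gt0// expRK; lra.
Qed.

(** The 8 is a 2 from splitting the square over two neighbours and a 4 from passing through the
    common limit of the weights; the rest inverts the lower bound [nbr_var_ge]. *)
Definition err_cst : R := 8 * weight_cst M ^+ 2 * expR (2 * M) / theta0.

Lemma err_cst_gt0 : 0 < err_cst.
Proof.
by rewrite divr_gt0// mulr_gt0 ?expR_gt0// mulr_gt0 ?exprn_gt0 ?weight_cst_gt0.
Qed.

(** The squared changes of the weights carry a factor [nbr_scale], which cancels against the
    variance in the denominator however small it is; only [nbr_len] remains. *)
Lemma nbr_mean_diff theta y i : 0 < theta <= M ->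
  (nbr_mean theta s y i - nbr_mean theta0 s y i) ^+ 2 / nbr_var theta0 s i
  <= err_cst * (nbr_len s i * nbr_sqr y i).
Proof.
move=> tM.
have v0 : 0 < nbr_var theta0 s i by apply: nbr_var_gt0 => //; exact: design_incr.
rewrite ler_pdivrMr//.
have [u [v uvP]] := nbr_weight_limit n_ge2 s_design i M_gt0.
have [lw rw] := uvP _ tM; have [lw0 rw0] := uvP _ theta0_itv.
rewrite /nbr_mean; set y1 := y (ord_pred i); set y2 := y (ordS i).
set a := left_weight theta s i in lw *; set b := right_weight theta s i in rw *.
set a0 := left_weight theta0 s i in lw0 *; set b0 := right_weight theta0 s i in rw0 *.
set K := weight_cst M ^+ 2 * _ in lw rw lw0 rw0.
have -> : a * y1 + b * y2 - (a0 * y1 + b0 * y2) = (a - a0) * y1 + (b - b0) * y2.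
  by ring.
apply: (le_trans (ler_sqrD _ _)); rewrite !exprMn.
have aK : (a - a0) ^+ 2 <= 4 * K.
  by have := ler_sqrD (a - u) (u - a0); rewrite -(sqrrN (u - a0)) opprB addrA subrK; lra.
have bK : (b - b0) ^+ 2 <= 4 * K.
  by have := ler_sqrD (b - v) (v - b0); rewrite -(sqrrN (v - b0)) opprB addrA subrK; lra.
have aKy := ler_wpM2r (sqr_ge0 y1) aK; have bKy := ler_wpM2r (sqr_ge0 y2) bK.
have lK : K <= weight_cst M ^+ 2 * (nbr_len s i * (nbr_var theta0 s i * (expR (2 * M) / theta0))).
  rewrite /K ler_wpM2l ?sqr_ge0// ler_wpM2l ?nbr_len_ge0//.
  have := nbr_var_ge i; rewrite expRN => /(ler_wpM2r (_ : 0 <= expR (2 * M) / theta0)).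
  rewrite divr_ge0 ?expR_ge0 ?(ltW theta0_gt0)// => /(_ isT); apply: le_trans.
  rewrite le_eqVlt; apply/orP; left; apply/eqP; field.
  by rewrite !gt_eqF ?expR_gt0.
have := ler_wpM2r (nbr_sqr_ge0 y i) lK; rewrite /nbr_sqr -/y1 -/y2 /err_cst; lra.
Qed.

Definition ratio_cst : R := 4 * M * expR (4 * M).

(** In the logarithm of the ratio [nbr_scale] cancels and 4 M l_i remains; exponentiating with l_i
    <= 1 gives both bounds. *)
Lemma nbr_var_ratio theta i : 0 < theta <= M ->
  `|theta * nbr_var theta0 s i / (theta0 * nbr_var theta s i) - 1|
    <= ratio_cst * nbr_len s i /\
  theta * nbr_var theta0 s i / (theta0 * nbr_var theta s i) <= expR (4 * M).
Proof.
move=> /andP[t0 tM].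
have v0 : 0 < nbr_var theta0 s i by apply: nbr_var_gt0 => //; exact: design_incr.
have v1 : 0 < nbr_var theta s i by apply: nbr_var_gt0 => //; exact: design_incr.
have l0 := nbr_len_ge0 s_design i; have l1 := nbr_len_le1 n_ge2 s_design i.
have := ln_nbr_var_bound n_ge2 s_design i theta0_gt0.
have := ln_nbr_var_bound n_ge2 s_design i t0.
move: (nbr_var theta0 s i) v0 (nbr_var theta s i) v1 => V0 v0 V v1 lnV lnV0.
set r := _ / _; have r0 : 0 < r by rewrite divr_gt0 ?mulr_gt0.
have lr : `|ln r| <= 4 * M * nbr_len s i.
  move: lnV lnV0.
  rewrite /r ln_div ?posrE ?mulr_gt0// !lnM ?posrE//.
  have := ler_wpM2r l0 tM.
  have : theta0 * nbr_len s i <= M * nbr_len s i.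
    by case/andP: theta0_itv => _ /(ler_wpM2r l0).
  by rewrite !ler_norml => ? ? /andP[? ?] /andP[? ?]; apply/andP; split; lra.
have lM : 4 * M * nbr_len s i <= 4 * M by rewrite ger_pMr// mulr_gt0.
move: lr; rewrite ler_norml => /andP[lr1 lr2].
have rM : r <= expR (4 * M * nbr_len s i) by rewrite -ler_ln ?posrE ?expR_gt0// expRK.
split; last by apply: (le_trans rM); rewrite ler_expR.
have rm : 1 - 4 * M * nbr_len s i <= r.
  rewrite -[r]lnK//; apply: le_trans (expR_ge1Dx _); lra.
have := expR_sub1_le (4 * M * nbr_len s i).
have : 4 * M * nbr_len s i * expR (4 * M * nbr_len s i) <= ratio_cst * nbr_len s i.
  rewrite (_ : ratio_cst * _ = 4 * M * nbr_len s i * expR (4 * M)); last first.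
    by rewrite /ratio_cst; ring.
  by rewrite ler_wpM2l ?ler_expR// mulr_ge0// mulr_ge0// ltW.
have : 4 * M * nbr_len s i <= ratio_cst * nbr_len s i.
  rewrite (_ : ratio_cst * _ = 4 * M * nbr_len s i * expR (4 * M)); last first.
    by rewrite /ratio_cst; ring.
  rewrite ler_peMr//.
    by rewrite mulr_ge0// mulr_ge0// ltW.
  by rewrite -[leLHS]expR0 ler_expR mulr_ge0// ltW.
by move=> ? ? ?; rewrite ler_norml; apply/andP; split; lra.
Qed.

Lemma std_err2_ge0 theta (y : 'I_n -> R) i : 0 < theta -> 0 <= std_err2 theta s y i.
Proof.
move=> t0; rewrite divr_ge0 ?sqr_ge0// ltW//.
by apply: nbr_var_gt0 => //; exact: design_incr.
Qed.

Definition expansion_cst (a : R) : R :=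
  theta0 / a * (expR (4 * M) + 2 * expR (4 * M) * err_cst + ratio_cst).

(** Two changes are separated: the variance ratio q, close to 1, and the prediction itself. The
    latter yields a cross term of order sqrt(l_i), split by the weighted arithmetic-geometric
    inequality with parameter eta. *)
Lemma std_err2_expansion (a eta theta : R) (y : 'I_n -> R) i :
  0 < a <= theta -> theta <= M -> 0 < eta <= 1 ->
  `|std_err2 theta s y i - theta0 / theta * std_err2 theta0 s y i|
  <= expansion_cst a * (eta * std_err2 theta0 s y i
       + eta^-1 * (nbr_len s i * (std_err2 theta0 s y i + nbr_sqr y i))).
Proof.
move=> /andP[a0 a_le] tM /andP[eta0 eta1].
have t0 : 0 < theta by exact: lt_le_trans a_le.
have t_itv : 0 < theta <= M by rewrite t0.
have v0 : 0 < nbr_var theta0 s i by apply: nbr_var_gt0 => //; exact: design_incr.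
have v1 : 0 < nbr_var theta s i by apply: nbr_var_gt0 => //; exact: design_incr.
have := nbr_mean_diff y i t_itv; have [] := nbr_var_ratio i t_itv.
have := std_err2_ge0 y i theta0_gt0; rewrite /std_err2.
move: (nbr_var theta0 s i) v0 (nbr_var theta s i) v1 => V0 v0 V v1.
move: (nbr_mean theta s y i) (nbr_mean theta0 s y i) => m m0.
have := nbr_len_ge0 s_design i; have := nbr_sqr_ge0 y i.
set l := nbr_len s i; set N := nbr_sqr y i => N0 l0.
set x0 := (y i - m0) ^+ 2 / V0 => x00.
set q := theta * V0 / _ => q1 qE dm.
have q0 : 0 < q by rewrite divr_gt0 ?mulr_gt0.
have ieta : 1 <= eta^-1 by rewrite invf_ge1.
pose z := (y i - m) ^+ 2 / V0.
have zx : `|z - x0| <= eta * x0 + 2 / eta * (err_cst * (l * N)).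
  (* One share of 2 / eta comes from the cross term, the other absorbs the square of m - m0, since 1
     <= 1 / eta. *)
  have amgm : `|(y i - m) ^+ 2 - (y i - m0) ^+ 2| <=
      eta * (y i - m0) ^+ 2 + 2 / eta * (m - m0) ^+ 2.
    have : 0 <= eta * (y i - m0) ^+ 2 + eta^-1 * (m - m0) ^+ 2 + 2 * ((y i - m0) * (m - m0)).
      rewrite (_ : _ + _ = eta^-1 * (eta * (y i - m0) + (m - m0)) ^+ 2); last first.
        by field; rewrite gt_eqF.
      by rewrite mulr_ge0 ?sqr_ge0// invr_ge0 ltW.
    have : 0 <= eta * (y i - m0) ^+ 2 + eta^-1 * (m - m0) ^+ 2 - 2 * ((y i - m0) * (m - m0)).
      rewrite (_ : _ - _ = eta^-1 * (eta * (y i - m0) - (m - m0)) ^+ 2); last first.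
        by field; rewrite gt_eqF.
      by rewrite mulr_ge0 ?sqr_ge0// invr_ge0 ltW.
    have := ler_wpM2r (sqr_ge0 (m - m0)) ieta; have := sqr_ge0 (m - m0).
    by move=> ? ? ? ?; rewrite ler_norml; apply/andP; split; lra.
  have V0i : 0 <= V0^-1 by rewrite invr_ge0 ltW.
  rewrite /z /x0 -mulrBl normrM (ger0_norm V0i).
  apply: (le_trans (ler_wpM2r V0i amgm)).
  rewrite (_ : (_ + _) / V0 = eta * x0 + 2 / eta * ((m - m0) ^+ 2 / V0)); last first.
    by rewrite /x0; ring.
  rewrite lerD2l ler_wpM2l//.
  by rewrite divr_ge0// ltW.
have -> : (y i - m) ^+ 2 / V - theta0 / theta * x0 = theta0 / theta * (q * z - x0).
  by rewrite /z /q; field; rewrite !gt_eqF.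
rewrite normrM gtr0_norm ?divr_gt0//.
(* Written as q (z - x0) + (q - 1) x0, with q bounded in the first product and q - 1 of order l in
   the second. *)
have qz : `|q * z - x0| <= expR (4 * M) * (eta * x0 + 2 / eta * (err_cst * (l * N)))
     + ratio_cst * l * x0.
  rewrite (_ : q * z - x0 = q * (z - x0) + (q - 1) * x0); last by ring.
  apply: (le_trans (ler_normD _ _)); rewrite (normrM q) (normrM (q - 1)).
  rewrite (gtr0_norm q0) (ger0_norm x00).
  apply: lerD; last exact: ler_wpM2r.
  by apply: ler_pM => //; exact: ltW.
have D : theta0 / theta <= theta0 / a by rewrite ler_pM2l// lef_pV2.
rewrite /expansion_cst -mulrA; apply: ler_pM => //.
  by rewrite divr_ge0// ltW.
apply: (le_trans qz).
clearbody x0 l N.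
have c1 : 0 <= expR (4 * M) by exact: expR_ge0.
have c2 : 0 < err_cst by exact: err_cst_gt0.
have c3 : 0 <= ratio_cst by rewrite mulr_ge0// mulr_ge0// ltW.
have i0 : 0 <= eta^-1 by rewrite invr_ge0 ltW.
have lx : l * x0 <= eta^-1 * (l * x0) by rewrite ler_peMl// mulr_ge0.
have := ler_wpM2l c3 lx.
have p1 : 0 <= eta * x0 by rewrite mulr_ge0// ltW.
have p2 : 0 <= eta^-1 * (l * x0) by rewrite !mulr_ge0.
have p3 : 0 <= eta^-1 * (l * N) by rewrite !mulr_ge0.
have := mulr_ge0 c1 p2; have := mulr_ge0 c1 p3.
have c12 : 0 <= expR (4 * M) * err_cst by rewrite mulr_ge0// ltW.
have := mulr_ge0 c12 p1; have := mulr_ge0 c12 p2.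
have := mulr_ge0 c3 p1; have := mulr_ge0 c3 p3.
move: (expR _) (err_cst) (ratio_cst) => E C1 C2 *.
lra.
Qed.

End UniformExpansion.

Section ScoreExpansion.
Variables (R : realType) (n : nat) (theta0 : R) (s : 'I_n -> R) (y : 'I_n -> R).

Definition total_err : R := \sum_i std_err2 theta0 s y i.

Definition weighted_err : R :=
  \sum_i nbr_len s i * (std_err2 theta0 s y i + nbr_sqr y i).

End ScoreExpansion.

Lemma log_score_expansion (R : realType) (theta0 a A : R) :
  0 < theta0 -> 0 < a -> a <= A ->
  exists2 C : R, 0 < C &
    forall n (s : 'I_n -> R) (y : 'cV[R]_n) (eta theta sigma2 : R),
      (2 <= n)%N -> is_design s -> 0 < eta <= 1 -> a <= theta <= A -> 0 < sigma2 ->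
      `|log_score theta s y sigma2 -
        (\sum_i ln (nbr_scale s i) + n%:R * ln (theta * sigma2)
         + theta0 / (theta * sigma2) * total_err theta0 s (y^~ 0))|
      <= C + C / sigma2 * (eta * total_err theta0 s (y^~ 0)
                           + eta^-1 * weighted_err theta0 s (y^~ 0)).
Proof.
(* M has to bound theta0 as well as theta, since predictions at both are compared. *)
move=> t00 a0 aA; pose M := Num.max theta0 A.
have AM : A <= M by rewrite le_max lexx orbT.
have t0M : 0 < theta0 <= M by rewrite t00 le_max lexx.
have M0 : 0 < M by case/andP: t0M => /lt_le_trans; apply.
(* The summand 4 M pays for the logarithms: remainders 2 M l_i, with the l_i summing to at most
   2. *)
pose C := expansion_cst M theta0 a + 4 * M.
have C1 : 0 < expansion_cst M theta0 a.
  rewrite mulr_gt0 ?divr_gt0// addr_gt0 ?addr_gt0 ?expR_gt0//.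
    by rewrite mulr_gt0 ?err_cst_gt0// mulr_gt0 ?expR_gt0.
  by rewrite mulr_gt0 ?expR_gt0// mulr_gt0.
exists C; first by rewrite addr_gt0// mulr_gt0.
move=> n s y eta theta sigma2 n2 ds eta01 /andP[at_ tA] s20.
have t0 : 0 < theta by exact: lt_le_trans at_.
have tM : theta <= M by exact: le_trans AM.
have incr : strictly_increasing s by exact: design_incr.
rewrite log_scoreE// /total_err /weighted_err.
set yy := y^~ 0.
have -> : n%:R * ln (theta * sigma2) = \sum_(i < n) ln (theta * sigma2).
  by rewrite sumr_const card_ord mulr_natl.
rewrite mulr_sumr -!big_split/= -sumrB.
apply: (le_trans (ler_norm_sum _ _ _)).
have -> : eta * (\sum_i std_err2 theta0 s yy i) + eta^-1 *
     (\sum_i nbr_len s i * (std_err2 theta0 s yy i + nbr_sqr yy i)) =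
   \sum_i (eta * std_err2 theta0 s yy i + eta^-1 *
      (nbr_len s i * (std_err2 theta0 s yy i + nbr_sqr yy i))).
  by rewrite !mulr_sumr -big_split.
have lenM : \sum_i 2 * M * nbr_len s i <= C.
  rewrite -mulr_sumr.
  have := sum_nbr_len n2 ds; rewrite -(ler_pM2l (_ : 0 < 2 * M)) ?mulr_gt0//.
  by rewrite /C; lra.
apply: le_trans (lerD lenM (lexx _)); rewrite mulr_sumr -big_split/=.
apply: ler_sum => i _.
have v0 : 0 < nbr_var theta s i by exact: nbr_var_gt0.
have lnV := ln_nbr_var_bound n2 ds i t0.
have xE := std_err2_expansion n2 ds t0M yy i (_ : 0 < a <= theta) tM eta01.
rewrite a0 at_ in xE; have {}xE := xE isT.
have l0 := nbr_len_ge0 ds i.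
set Z := eta * _ + _ in xE *.
have Z0 : 0 <= Z.
  case/andP: eta01 => eta0 _.
  rewrite addr_ge0// mulr_ge0 ?invr_ge0 ?(ltW eta0)// ?std_err2_ge0//.
  by rewrite mulr_ge0// addr_ge0 ?std_err2_ge0// nbr_sqr_ge0.
have -> : ln (sigma2 * nbr_var theta s i) + std_err2 theta s yy i / sigma2 -
  (ln (nbr_scale s i) + ln (theta * sigma2) +
   theta0 / (theta * sigma2) * std_err2 theta0 s yy i) =
  (ln (nbr_var theta s i) - ln theta - ln (nbr_scale s i)) +
  (std_err2 theta s yy i - theta0 / theta * std_err2 theta0 s yy i) / sigma2.
  move: (nbr_var theta s i) v0 {lnV xE} => V v0.
  move: (std_err2 _ _ _ _) (std_err2 _ _ _ _) => x1 x2.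
  rewrite !lnM ?posrE//.
  by field; rewrite !gt_eqF.
apply: (le_trans (ler_normD _ _)); apply: lerD.
  by apply: (le_trans lnV); rewrite ler_wpM2r// ler_pM2l.
rewrite normrM (gtr0_norm (_ : 0 < sigma2^-1)) ?invr_gt0//.
rewrite [leRHS]mulrAC ler_wpM2r ?invr_ge0 ?(ltW s20)//.
apply: (le_trans xE); rewrite ler_wpM2r// /C lerDl mulr_ge0// ltW//.
Qed.

(** * Moments of Gaussian laws *)

Section NormalIntegral.
Variables (R : realType) (m s : R).
Local Notation mu := (@lebesgue_measure R).

(** The change of variables goes through the Radon-Nikodym derivative, which equals the density
    almost everywhere because both have the same integrals over measurable sets. *)
Lemma ge0_integral_normal_prob (f : _ -> \bar R) :
  measurable_fun setT f -> (forall x, 0 <= f x)%E ->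
  (\int[normal_prob m s]_x f x = \int[mu]_x (f x * (normal_pdf m s x)%:E))%E.
Proof.
move=> mf f0; have dom := @normal_prob_dominates R m s.
rewrite -(@Radon_Nikodym_SigmaFinite.change_of_variables _ _ R (normal_prob m s) mu dom)//.
have mpdf : measurable_fun setT (fun x => (normal_pdf m s x)%:E).
  by apply/measurable_EFinP; exact: measurable_normal_pdf.
have intd := Radon_Nikodym_SigmaFinite.f_integrable dom.
apply: ge0_ae_eq_integral => //.
- by apply: emeasurable_funM => //; exact: measurable_int intd.
- exact: emeasurable_funM.
- by move=> x _; rewrite mule_ge0// Radon_Nikodym_SigmaFinite.f_ge0.
- by move=> x _; rewrite mule_ge0// lee_fin normal_pdf_ge0.
apply: ae_eqe_mul2l; apply: integral_ae_eq => // A _ mA.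
by rewrite -Radon_Nikodym_SigmaFinite.f_integral.
Qed.

Lemma normal_mgf (t : R) : s != 0 ->
  (\int[normal_prob m s]_x (expR (t * x))%:E
   = (expR (t * m + t ^+ 2 * s ^+ 2 / 2))%:E)%E.
Proof.
move=> s0; rewrite ge0_integral_normal_prob; last 2 first.
- by apply/measurable_EFinP/measurableT_comp => //; exact: measurable_funM.
- by move=> x; rewrite lee_fin expR_ge0.
under eq_integral => x _.
  (* Completing the square leaves a constant times the density with mean shifted to m + t s^2. *)
  rewrite -EFinM (_ : expR _ * _ = expR (t * m + t ^+ 2 * s ^+ 2 / 2)
     * normal_pdf (m + t * s ^+ 2) s x); last first.
    rewrite !normal_pdfE// /normal_fun/= mulrCA [RHS]mulrCA -!expRD.
    by congr (_ * expR _); field.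
  rewrite EFinM.
  over.
rewrite ge0_integralZl//=.
- by rewrite integral_normal_pdf mule1.
- by apply/measurable_EFinP; exact: measurable_normal_pdf.
- by move=> x _; rewrite lee_fin normal_pdf_ge0.
Qed.

End NormalIntegral.

(** * Even moments by integration by parts *)

Section GaussianIntegrals.
Variables (R : realType) (c : R).
Hypothesis c_gt0 : 0 < c.
Local Notation mu := (@lebesgue_measure R).

Let e (x : R) := expR (- (c * x ^+ 2)).
Let F n (x : R) := x ^+ n * e x.

Let is_derive_F n (x : R) :
  is_derive x 1 (F n.+1) (n.+1%:R * F n x - 2 * c * F n.+2 x).
Proof.
have eE : e = expR \o horner (- (c *: 'X^2)).
  by apply/funext => y; rewrite /e /= hornerN hornerZ hornerXn.
have -> : F n.+1 = horner ('X^(n.+1)) * e.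
  by apply/funext => y; rewrite /F fctE hornerXn.
have de : is_derive x 1 e (- (2 * c * x) * e x).
  pose q : {poly R} := - (c *: 'X^2).
  have := is_derive1_comp (is_derive_expR q.[x]) (is_derive_poly q x).
  rewrite -/(expR \o horner q) -eE => /is_derive_eq; apply.
  rewrite (_ : expR q.[x] = e x); last by rewrite /e /q hornerN hornerZ hornerXn.
  rewrite (_ : q^`().[x] = - (2 * c * x)); first by rewrite mulrC.
  by rewrite /q derivN derivZ derivXn hornerN hornerZ hornerMn hornerXn; ring.
apply: is_derive_eq (is_deriveM (is_derive_poly _ x) de) _.
change (('X^(n.+1)).[x] * (- (2 * c * x) * e x) + e x * ('X^(n.+1))^`().[x]
  = n.+1%:R * F n x - 2 * c * F n.+2 x).
rewrite derivXn hornerMn !hornerXn /= /F.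
by move: (e x) => y; rewrite -mulr_natl !exprS; move: (x ^+ n) => z; ring.
Qed.

Let derivable_F n x : derivable (F n.+1) x 1.
Proof. by case: (is_derive_F n x). Qed.

Let F' n x : (F n.+1)^`()%classic x = n.+1%:R * F n x - 2 * c * F n.+2 x.
Proof. by rewrite derive1E; case: (is_derive_F n x). Qed.

Let continuous_e : continuous e.
Proof.
move=> x; apply: continuous_comp; last exact: continuous_expR.
by apply: (@cvgN _ R^o); apply: cvgM; [exact: cvg_cst|exact: exprn_continuous].
Qed.

Let continuous_F n : continuous (F n).
Proof. by move=> x; apply: cvgM; [exact: exprn_continuous|exact: continuous_e]. Qed.

Let measurable_F n : measurable_fun setT (fun x => (F n x)%:E).
Proof. by apply/measurable_EFinP; exact: continuous_measurable_fun. Qed.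

Let F_ge0 n x : 0 <= x -> 0 <= F n x.
Proof. by move=> x0; rewrite mulr_ge0 ?exprn_ge0 ?expR_ge0. Qed.

Let F_cvg0 k : F k.*2.+1 x @[x --> +oo] --> (0 : R).
Proof.
(* Since exp(y) >= y^(k+1) / (k+1)! at y = c x^2, the function is at most K / x. *)
pose K := (k.+1)`!%:R / c ^+ k.+1.
apply: (@squeeze_cvgr _ _ _ _ (cst 0) (fun x => K * x^-1)).
- near=> x; have x0 : 0 < x by [].
  rewrite (F_ge0 _ (ltW x0))/=.
  have := @expR_ge1Dxn R (c * x ^+ 2) k (ltW (mulr_gt0 c_gt0 (exprn_gt0 _ x0))).
  have : 0 < (c * x ^+ 2) ^+ k.+1 / (k.+1)`!%:R.
    by rewrite divr_gt0 ?exprn_gt0 ?mulr_gt0 ?exprn_gt0// ltr0n fact_gt0.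
  set y := (c * x ^+ 2) ^+ k.+1 / _ => y0 ey.
  rewrite /F /e expRN.
  have : (expR (c * x ^+ 2))^-1 <= y^-1 by rewrite lef_pV2 ?posrE ?expR_gt0//; apply: le_trans ey; rewrite lerDr.
  move/(ler_wpM2l (exprn_ge0 k.*2.+1 (ltW x0)))/le_trans; apply.
  rewrite /y /K exprMn -exprM mul2n doubleS !exprS invf_div.
  rewrite le_eqVlt; apply/orP; left; apply/eqP; field.
  by rewrite !gt_eqF ?exprn_gt0.
- exact: cvg_cst.
- rewrite -[X in _ --> X](mulr0 K); apply: cvgM; first exact: cvg_cst.
  by apply/gtr0_cvgV0 => //; near=> x.
Unshelve. all: by end_near. Qed.

(** Subtraction is avoided because the integrals are extended reals not yet known to be finite; the
    integral of a nonnegative difference is rewritten as an equality of sums. *)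
Let integral_shift a (D : set R) (n1 n2 : nat) (u v : R) : measurable D ->
  (forall x, D x -> 0 <= x) -> 0 <= u -> 0 <= v ->
  (forall x, D x -> 0 <= u * F n1 x - v * F n2 x) ->
  (\int[mu]_(x in D) (u * F n1 x - v * F n2 x)%:E = a%:E)%E ->
  (u%:E * \int[mu]_(x in D) (F n1 x)%:E
   = a%:E + v%:E * \int[mu]_(x in D) (F n2 x)%:E)%E.
Proof.
move=> mD D0 u0 v0 uv <-.
have mF n : measurable_fun D (fun x => (F n x)%:E) by exact: measurable_funTS.
have mZ w n : measurable_fun D (fun x => (w * F n x)%:E).
  apply/measurable_EFinP/measurable_funTS/measurable_funM => //.
  exact: continuous_measurable_fun.
have FD n x : D x -> (0 <= (F n x)%:E)%E by move=> Dx; rewrite lee_fin F_ge0// D0.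
have ZE n w : 0 <= w ->
    (w%:E * \int[mu]_(x in D) (F n x)%:E = \int[mu]_(x in D) (w * F n x)%:E)%E.
  move=> w0; under [RHS]eq_integral do rewrite EFinM.
  by rewrite ge0_integralZl//; [exact: mF|move=> x; exact: FD].
rewrite !ZE// -ge0_integralD//=.
- by apply: eq_integral => x _; rewrite -EFinD subrK.
- under eq_fun do rewrite EFinB.
  by apply: emeasurable_funB; exact: mZ.
- by move=> x Dx; rewrite lee_fin mulr_ge0// F_ge0// D0.
- exact: mZ.
Qed.

(** The derivative of F (2k+1) is (2k+1) F (2k) - 2c F (2k+2), and F (2k+1) vanishes at 0 and at
    infinity. The derivative changes sign once, so the half-line is cut there and each piece has an
    integrand of constant sign. *)
Let even_moment_step_half k :
  ((2 * c)%:E * \int[mu]_(x in `[0%R, +oo[) (F k.*2.+2 x)%:E =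
   k.*2.+1%:R%:E * \int[mu]_(x in `[0%R, +oo[) (F k.*2 x)%:E)%E.
Proof.
(* The positive zero of the derivative when k > 0 and also when k = 0: 2 c r^2 = 2k + 1. *)
pose r := Num.sqrt (k.*2.+1%:R / (2 * c)).
have c20 : 0 < 2 * c by rewrite mulr_gt0.
have k0 : 0 < (k.*2.+1)%:R :> R by [].
have r0 : 0 < r by rewrite sqrtr_gt0 divr_gt0.
have rE : 2 * c * r ^+ 2 = k.*2.+1%:R.
  by rewrite sqr_sqrtr ?divr_ge0 ?ltW// mulrC divfK// gt_eqF.
have fE x : k.*2.+1%:R * F k.*2 x - 2 * c * F k.*2.+2 x =
    F k.*2 x * (2 * c * (r ^+ 2 - x ^+ 2)).
  by rewrite mulrBr rE /F !exprS; ring.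
pose f x := k.*2.+1%:R * F k.*2 x - 2 * c * F k.*2.+2 x.
have cf : continuous f.
  move=> x; apply: cvgB; (apply: cvgM; first exact: cvg_cst); exact: continuous_F.
have cF x : F k.*2.+1 y @[y --> x] --> F k.*2.+1 x by exact: continuous_F.
have I1 : (\int[mu]_(x in `[0%R, r]) (f x)%:E = (F k.*2.+1 r)%:E)%E.
  rewrite (@continuous_FTC2 _ f (F k.*2.+1) 0 r)//.
  - by rewrite [F _ 0]/F expr0n/= mul0r sube0.
  - exact: continuous_subspaceT.
  - split; first by move=> x _; exact: derivable_F.
    + exact: cvg_at_right_filter.
    + exact: cvg_at_left_filter.
have I2 : (\int[mu]_(x in `[r, +oo[) (- f x)%:E = (F k.*2.+1 r)%:E)%E.
  rewrite (@ge0_continuous_FTC2y _ (\- f) (\- F k.*2.+1) r 0)//.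
  - by rewrite -EFinB sub0r opprK.
  - move=> x rx; have x0 : 0 <= x by apply: le_trans rx; exact: ltW.
    rewrite /= /f fE oppr_ge0 mulr_ge0_le0 ?F_ge0// pmulr_rle0// subr_le0.
    by rewrite lerXn2r ?nnegrE// ltW.
  - by apply: continuous_subspaceT => x; apply: (@cvgN _ R^o); exact: cf.
  - by rewrite -[X in _ --> X]oppr0; apply: (@cvgN _ R^o); exact: F_cvg0.
  - by move=> x _; apply: derivableN; exact: derivable_F.
  - by apply: cvg_at_right_filter; apply: (@cvgN _ R^o); exact: cF.
  - by move=> x _; rewrite derive1N ?F'//; exact: derivable_F.
have S n : (\int[mu]_(x in `[0%R, +oo[) (F n x)%:E =
    \int[mu]_(x in `[0%R, r]) (F n x)%:E + \int[mu]_(x in `[r, +oo[) (F n x)%:E)%E.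
  rewrite -(@integral_itv_obnd_cbnd _ r); last exact: measurable_funTS.
  rewrite -ge0_integral_setU//=.
  - by rewrite -itv_bndbnd_setU// bnd_simp ltW.
  - by apply: measurable_funTS; exact: measurable_F.
  - move=> x; rewrite !in_itv/= !andbT lee_fin => -[/andP[x0 _]|rx]; apply: F_ge0 => //.
    by rewrite ltW// (lt_trans r0).
  - apply/disj_setPS => x /=; rewrite !in_itv/= andbT => -[/andP[_ xr] rx].
    by rewrite ltNge xr in rx.
have D0 x : x \in `[0, r] -> 0 <= x by rewrite in_itv/= => /andP[].
have Dr x : x \in `[r, +oo[ -> 0 <= x.
  by rewrite in_itv/= andbT => /(lt_le_trans r0)/ltW.
have E1 := @integral_shift (F k.*2.+1 r) `[0, r]%classic k.*2 k.*2.+2 _ _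
  (measurable_itv _) D0 (ltW k0) (ltW c20).
have E2 := @integral_shift (F k.*2.+1 r) `[r, +oo[%classic k.*2.+2 k.*2 _ _
  (measurable_itv _) Dr (ltW c20) (ltW k0).
have int_ge0 (D : set R) n : (forall x, D x -> 0 <= x) ->
    (0 <= \int[mu]_(x in D) (F n x)%:E)%E.
  by move=> Dge0; apply: integral_ge0 => x Dx; rewrite lee_fin F_ge0// Dge0.
rewrite !S ge0_muleDr ?int_ge0// [RHS]ge0_muleDr ?int_ge0// E1 ?E2.
- by rewrite addeCA addeA.
- move=> x xr; rewrite -opprB oppr_ge0; have x0 := Dr _ xr.
  rewrite fE mulr_ge0_le0 ?F_ge0// pmulr_rle0// subr_le0.
  by move: xr; rewrite /= in_itv/= andbT => rx; rewrite lerXn2r ?nnegrE// ltW.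
- by rewrite -I2; apply: eq_integral => x _; rewrite opprB.
- move=> x xr; have x0 := D0 _ xr.
  rewrite fE mulr_ge0 ?F_ge0// pmulr_rge0// subr_ge0.
  by move: xr; rewrite /= in_itv/= => /andP[_ xr]; rewrite lerXn2r ?nnegrE// ltW.
- exact: I1.
Qed.

Lemma even_moment_step k :
  ((2 * c)%:E * \int[mu]_x (x ^+ k.*2.+2 * expR (- (c * x ^+ 2)))%:E =
   k.*2.+1%:R%:E * \int[mu]_x (x ^+ k.*2 * expR (- (c * x ^+ 2)))%:E)%E.
Proof.
have sym n : (\int[mu]_x (F n.*2 x)%:E = 2%:E * \int[mu]_(x in `[0%R, +oo[) (F n.*2 x)%:E)%E.
  have -> : `[0%R, +oo[%classic = [set x : R | 0 <= x] by rewrite -set_itvcy.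
  apply: ge0_symfun_integralT => //.
  - by move=> x; rewrite mulr_ge0 ?expR_ge0// -mul2n exprM exprn_ge0// sqr_ge0.
  - by move=> x; rewrite /F /e /= sqrrN -mul2n !exprM sqrrN.
by rewrite (sym k.+1) (sym k) muleCA even_moment_step_half muleCA.
Qed.

End GaussianIntegrals.

(** The double factorial (2k - 1)!!, moment of order 2k of a standard Gaussian variable. *)
Definition dfact (R : realType) (k : nat) : R := \prod_(i < k) i.*2.+1%:R.

Lemma normal_even_moment (R : realType) (s : R) (k : nat) : 0 < s ->
  (\int[normal_prob 0 s]_x (x ^+ k.*2)%:E = (dfact R k * s ^+ k.*2)%:E)%E.
Proof.
move=> s0; have sN0 : s != 0 by rewrite gt_eqF.
pose c := (s ^+ 2 *+ 2)^-1.
have c0 : 0 < c by rewrite invr_gt0 pmulrn_lgt0 ?exprn_gt0.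
have intE n : (\int[normal_prob 0 s]_x (x ^+ n.*2)%:E = (normal_peak s)%:E *
    \int[lebesgue_measure]_x (x ^+ n.*2 * expR (- (c * x ^+ 2)))%:E)%E.
  have x2n (x : R) : 0 <= x ^+ n.*2 by rewrite -mul2n exprM exprn_ge0// sqr_ge0.
  rewrite ge0_integral_normal_prob; last 2 first.
  - by apply/measurable_EFinP; exact: exprn_measurable.
  - by move=> x; rewrite lee_fin.
  rewrite -ge0_integralZl//=.
  - apply: eq_integral => x _; rewrite normal_pdfE// -!EFinM /normal_fun subr0.
    by rewrite /c mulrCA mulNr (mulrC (x ^+ 2)).
  - apply/measurable_EFinP/measurable_funM => //.
    apply: measurableT_comp => //; apply: measurableT_comp => //.
    exact: measurable_funM.
  - by move=> x _; rewrite lee_fin mulr_ge0 ?expR_ge0.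
  - by rewrite lee_fin normal_peak_ge0.
elim: k => [|k IH].
  rewrite /dfact big_ord0 expr0 mulr1.
  under eq_integral do rewrite expr0.
  by rewrite integral_cst//= probability_setT mule1.
have := congr1 (fun z => (normal_peak s)%:E * z)%E (even_moment_step c0 k).
rewrite -doubleS ![((normal_peak s)%:E * (_%:E * _))%E]muleCA -!intE IH.
move=> /(congr1 (fun z => (s ^+ 2)%:E * z)%E); rewrite muleA -!EFinM.
rewrite (_ : s ^+ 2 * (2 * c) = 1) ?mul1e => [->|]; last by rewrite /c; field.
congr (_%:E); rewrite /dfact big_ord_recr/= doubleS !exprS; ring.
Qed.

(** * Random variables with moments of all orders *)

Section Moments.
Context {d : measure_display} {T : measurableType d} {R : realType}.
Variable P : probability T R.
Implicit Types f g : T -> R.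

(** This class is closed under sums and products, so linearity of expectation applies to every
    polynomial in the observations. *)
Definition has_moments f := measurable_fun setT f /\
  forall k, P.-integrable setT (EFin \o (fun w => f w ^+ k)).

Lemma dominated_integrable f g : measurable_fun setT f ->
  P.-integrable setT (EFin \o g) -> (forall w, `|f w| <= g w) ->
  P.-integrable setT (EFin \o f).
Proof.
move=> mf ig fg; apply: le_integrable ig => //; first exact/measurable_EFinP.
by move=> w _ /=; rewrite lee_fin (le_trans (fg w))// ler_norm.
Qed.

Lemma integrable_RD f g : P.-integrable setT (EFin \o f) ->
  P.-integrable setT (EFin \o g) ->
  P.-integrable setT (EFin \o (fun w => f w + g w)).
Proof.
move=> fi gi; have := integrableD measurableT fi gi.
by apply: eq_integrable => // w _; rewrite /= EFinD.
Qed.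

Lemma integrable_RZ (k : R) f : P.-integrable setT (EFin \o f) ->
  P.-integrable setT (EFin \o (fun w => k * f w)).
Proof.
move=> fi; have := integrableZl measurableT k fi.
by apply: eq_integrable => // w _; rewrite /= EFinM.
Qed.

Lemma integrable_Rcst (k : R) : P.-integrable setT (EFin \o (fun _ : T => k)).
Proof. exact: finite_measure_integrable_cst. Qed.

Lemma has_moments_even f : measurable_fun setT f ->
  (forall k, P.-integrable setT (EFin \o (fun w => f w ^+ k.*2))) -> has_moments f.
Proof.
move=> mf fi; split=> // k.
apply: (dominated_integrable (measurable_funX _ mf)
  (integrable_RD (integrable_Rcst 1) (fi k))) => w.
rewrite -mul2n mulnC exprM normrX -[(f w ^+ k) ^+ 2]real_normK ?num_real// normrX.
by have := sqr_ge0 (`|f w| ^+ k - 2^-1); rewrite sqrrB; lra.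
Qed.

Lemma has_moments_integrable f : has_moments f -> P.-integrable setT (EFin \o f).
Proof. by move=> [_ /(_ 1%N)]; under eq_fun do rewrite expr1. Qed.

Lemma has_moments_monomial f g i j : has_moments f -> has_moments g ->
  P.-integrable setT (EFin \o (fun w => f w ^+ i * g w ^+ j)).
Proof.
move=> [mf fi] [mg gi].
have mfg : measurable_fun setT (fun w => f w ^+ i * g w ^+ j).
  by apply: measurable_funM; exact: measurable_funX.
apply: (dominated_integrable mfg (integrable_RD (fi i.*2) (gi j.*2))) => w.
rewrite -!mul2n (mulnC 2) (mulnC 2) !exprM; move: (f w ^+ i) (g w ^+ j) => x y.
have := sqr_ge0 (x - y); have := sqr_ge0 (x + y); rewrite sqrrB sqrrD => ? ?.
have := sqr_ge0 x; have := sqr_ge0 y => ? ?.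
by rewrite ler_norml; apply/andP; split; lra.
Qed.

Lemma has_moments_cst (k : R) : has_moments (fun _ => k).
Proof. by split => // j; exact: integrable_Rcst. Qed.

Lemma has_momentsM f g : has_moments f -> has_moments g ->
  has_moments (fun w => f w * g w).
Proof.
move=> Hf Hg; split; first by apply: measurable_funM; [exact: Hf.1|exact: Hg.1].
by move=> k; under eq_fun do rewrite exprMn; exact: has_moments_monomial.
Qed.

Lemma integrable_Rsum (I : Type) (r : seq I) (f : I -> T -> R) :
  (forall i, P.-integrable setT (EFin \o f i)) ->
  P.-integrable setT (EFin \o (fun w => \sum_(i <- r) f i w)).
Proof.
move=> fi; elim: r => [|i r IH].
  by under eq_fun do rewrite big_nil; exact: integrable_Rcst.
by under eq_fun do rewrite big_cons; exact: integrable_RD.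
Qed.

Lemma has_momentsD f g : has_moments f -> has_moments g ->
  has_moments (fun w => f w + g w).
Proof.
move=> Hf Hg; split; first by apply: measurable_funD; [exact: Hf.1|exact: Hg.1].
move=> k; under eq_fun do rewrite exprDn.
apply: integrable_Rsum => i; under eq_fun do rewrite -mulr_natl.
by apply: integrable_RZ; exact: has_moments_monomial.
Qed.

Lemma has_momentsZ (k : R) f : has_moments f -> has_moments (fun w => k * f w).
Proof. by apply: has_momentsM; exact: has_moments_cst. Qed.

Lemma has_momentsB f g : has_moments f -> has_moments g ->
  has_moments (fun w => f w - g w).
Proof.
move=> Hf Hg; under [X in has_moments X]eq_fun do rewrite -mulN1r.
by apply: has_momentsD => //; exact: has_momentsZ.
Qed.

Lemma has_momentsX n f : has_moments f -> has_moments (fun w => f w ^+ n).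
Proof.
move=> Hf; elim: n => [|n IH]; first exact: has_moments_cst.
by under [X in has_moments X]eq_fun do rewrite exprS; exact: has_momentsM.
Qed.

Lemma has_moments_sum (I : Type) (r : seq I) (f : I -> T -> R) :
  (forall i, has_moments (f i)) -> has_moments (fun w => \sum_(i <- r) f i w).
Proof.
move=> Hf; elim: r => [|i r IH].
  by under [X in has_moments X]eq_fun do rewrite big_nil; exact: has_moments_cst.
by under [X in has_moments X]eq_fun do rewrite big_cons; exact: has_momentsD.
Qed.

Definition Ex f : R := \int[P]_w f w.

Lemma ExD f g : has_moments f -> has_moments g ->
  Ex (fun w => f w + g w) = Ex f + Ex g.
Proof. by move=> *; rewrite /Ex RintegralD//; exact: has_moments_integrable. Qed.

Lemma ExZ k f : has_moments f -> Ex (fun w => k * f w) = k * Ex f.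
Proof. by move=> *; rewrite /Ex RintegralZl//; exact: has_moments_integrable. Qed.

Lemma ExB f g : has_moments f -> has_moments g ->
  Ex (fun w => f w - g w) = Ex f - Ex g.
Proof. by move=> *; rewrite /Ex RintegralB//; exact: has_moments_integrable. Qed.

Lemma Ex_cst k : Ex (fun _ => k) = k.
Proof. by rewrite /Ex /Rintegral integral_cst//= probability_setT mule1. Qed.

Lemma Ex_sum (I : Type) (r : seq I) (f : I -> T -> R) :
  (forall i, has_moments (f i)) ->
  Ex (fun w => \sum_(i <- r) f i w) = \sum_(i <- r) Ex (f i).
Proof.
move=> Hf; elim: r => [|i r IH].
  by rewrite big_nil -[RHS]Ex_cst; congr Ex; apply/funext => w; rewrite big_nil.
rewrite big_cons -IH -ExD//; last exact: has_moments_sum.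
by congr Ex; apply/funext => w; rewrite big_cons.
Qed.

Lemma Ex_le f g : has_moments f -> has_moments g -> (forall w, f w <= g w) ->
  Ex f <= Ex g.
Proof.
by move=> Hf Hg fg; apply: le_Rintegral => //; exact: has_moments_integrable.
Qed.

Lemma Ex_ge0 f : (forall w, 0 <= f w) -> 0 <= Ex f.
Proof. by move=> f0; apply: Rintegral_ge0 => w _; exact: f0. Qed.

Lemma EFin_Ex f : has_moments f -> (\int[P]_w (f w)%:E)%E = (Ex f)%:E.
Proof.
move=> Hf; rewrite /Ex /Rintegral fineK//.
by apply: integrable_fin_num => //; exact: has_moments_integrable.
Qed.

End Moments.

Section GaussianMoments.
Context {d : measure_display} {T : measurableType d} {R : realType}.
Variables (P : probability T R) (X : T -> R).
Hypotheses (mX : measurable_fun setT X) (X_mean0 : (\int[P]_w (X w)%:E)%E = 0%E).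

Let ge0_integral_law (nu : probability (measurableTypeR R) R) (f : R -> R) :
  (forall V : set R, measurable V -> P (X @^-1` V) = nu V) ->
  measurable_fun setT f -> (forall x, 0 <= f x) ->
  (\int[P]_w (f (X w))%:E = \int[nu]_x (f x)%:E)%E.
Proof.
move=> XN mf f0.
have := @ge0_integral_pushforward _ _ _ (measurableTypeR R) R X mX P setT (EFin \o f) measurableT.
rewrite preimage_setT => <-.
- by apply: eq_measure_integral => A mA _; exact: XN.
- exact/measurable_EFinP.
- by move=> x _; rewrite lee_fin.
Qed.

(* Jensen's inequality [1 + t E X <= E exp(tX)] for all [t] excludes a drift. *)
Let mgf_mean0 (m v : R) : 0 <= v ->
  (forall t, \int[P]_w (expR (t * X w))%:E = (expR (t * m + t ^+ 2 * v / 2))%:E)%E ->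
  m = 0.
Proof.
move=> v0 mgf.
have mexp t : measurable_fun setT (fun w => expR (t * X w)).
  by apply: measurableT_comp => //; exact: measurable_funM.
have iexp t : P.-integrable setT (EFin \o (fun w => expR (t * X w))).
  apply/integrableP; split; first exact/measurable_EFinP.
  under eq_integral do rewrite /= ger0_norm ?expR_ge0//.
  by rewrite mgf ltry.
have iX : P.-integrable setT (EFin \o X).
  apply: (dominated_integrable mX (integrable_RD (iexp 1) (iexp (- 1)))) => w.
  have := expR_ge1Dx (1 * X w); have := expR_ge1Dx (- 1 * X w).
  have := expR_gt0 (1 * X w); have := expR_gt0 (- 1 * X w).
  by rewrite mul1r mulN1r ler_norml => *; apply/andP; split; lra.
have ge0 t : 0 <= t * m + t ^+ 2 * v / 2.
  rewrite -ler_expR expR0 -lee_fin -mgf.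
  have <- : (\int[P]_w (1 + t * X w)%:E = 1)%E.
    under eq_integral do rewrite EFinD EFinM.
    rewrite integralD//=; last exact: integrableZl; last exact: integrable_Rcst.
    rewrite integralZl// X_mean0 mule0 adde0 integral_cst//= probability_setT.
    by rewrite mule1.
  apply: le_integral => //=.
  - exact: (integrable_RD (integrable_Rcst _ _) (integrable_RZ _ _)).
  - exact: iexp.
  - by move=> w _; rewrite lee_fin expR_ge1Dx.
apply/eqP; apply: contraT => m0.
(* A multiple of -m makes the exponent negative unless m = 0; the denominator v + 1 rather than v
   covers the Dirac case v = 0. *)
have := ge0 (- m / (v + 1)).
rewrite (_ : _ + _ = - (m ^+ 2 * (v / 2 + 1) / (v + 1) ^+ 2)); last first.
  by field; rewrite gt_eqF// ltr_wpDl.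
rewrite oppr_ge0 leNgt divr_gt0 ?exprn_gt0//; last by rewrite ltr_wpDl.
by rewrite mulr_gt0 ?exprn_even_gt0//; lra.
Qed.

Let even_moments : gaussian_law (fun V => P (X @^-1` V)) ->
  exists2 v, 0 <= v & forall k,
    (\int[P]_w (X w ^+ k.*2)%:E = (dfact R k * v ^+ k)%:E)%E.
Proof.
have x2k k (x : R) : 0 <= x ^+ k.*2 by rewrite -mul2n exprM exprn_ge0// sqr_ge0.
case=> [[m XN]|[m [s [s0 XN]]]].
- have m0 : m = 0.
    apply: (@mgf_mean0 m 0) => // t.
    rewrite (@ge0_integral_law (@dirac _ (measurableTypeR R) m R) (fun x => expR (t * x)))//.
    + rewrite integral_dirac// ?mulr0 ?mul0r ?addr0 ?diracT ?mul1e//.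
      by apply/measurable_EFinP/measurableT_comp => //; exact: measurable_funM.
    + by apply: measurableT_comp => //; exact: measurable_funM.
  exists 0 => // k; rewrite (@ge0_integral_law (@dirac _ (measurableTypeR R) m R) (fun x => x ^+ k.*2))//.
  rewrite integral_dirac ?diracT ?mul1e ?m0//; last first.
    by apply/measurable_EFinP; exact: exprn_measurable.
  by case: k => [|k]; rewrite ?expr0 ?mulr1 ?/dfact ?big_ord0// !expr0n/= mulr0.
- have m0 : m = 0.
    apply: (@mgf_mean0 m (s ^+ 2)) => [|t]; first exact: sqr_ge0.
    rewrite (@ge0_integral_law (normal_prob m s) (fun x => expR (t * x)))//.
    + by rewrite normal_mgf// gt_eqF.
    + by apply: measurableT_comp => //; exact: measurable_funM.
  exists (s ^+ 2) => [|k]; first exact: sqr_ge0.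
  rewrite (@ge0_integral_law (normal_prob m s) (fun x => x ^+ k.*2))//.
  by rewrite m0 normal_even_moment// -exprM mul2n.
Qed.

(** The variance parameter is expressed as the second moment, so that the law itself can be
    forgotten afterwards. *)
Lemma gaussian_law_moments : gaussian_law (fun V => P (X @^-1` V)) ->
  has_moments P X /\ forall k,
    Ex P (fun w => X w ^+ k.*2) = dfact R k * Ex P (fun w => X w ^+ 2) ^+ k.
Proof.
move=> /even_moments[v v0 mE].
have x2k k (x : R) : 0 <= x ^+ k.*2 by rewrite -mul2n exprM exprn_ge0// sqr_ge0.
have HX : has_moments P X.
  apply: has_moments_even => // k; apply/integrableP; split.
    by apply/measurable_EFinP; exact: measurable_funX.
  by under eq_integral do rewrite /= ger0_norm//; rewrite mE ltry.
have ExE k : Ex P (fun w => X w ^+ k.*2) = dfact R k * v ^+ k.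
  by apply: EFin_inj; rewrite -EFin_Ex ?mE//; exact: has_momentsX.
split=> // k; rewrite (ExE 1%N) ExE; congr (_ * _ ^+ k).
by rewrite /dfact big_ord1 mul1r expr1.
Qed.

End GaussianMoments.

(** * Fourth moment of a sum of squares of uncorrelated Gaussian variables *)

Lemma poly_eq_horner (R : numDomainType) (p q : {poly R}) :
  (forall x, p.[x] = q.[x]) -> p = q.
Proof.
move=> pq; apply/eqP; rewrite -subr_eq0; apply/negPn/negP => r0.
pose rs := [seq i%:R : R | i <- iota 0 (size (p - q))].
have rs_root : all (root (p - q)) rs.
  by apply/allP => x _; rewrite rootE !hornerE pq subrr.
have rs_uniq : uniq rs by rewrite map_inj_uniq ?iota_uniq// => i j /eqP; rewrite eqr_nat => /eqP.
by have := max_poly_roots r0 rs_root rs_uniq; rewrite size_map size_iota ltnn.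
Qed.

Lemma coef2_binomial (R : comNzRingType) (a b : R) (k : nat) :
  ((a *: 'X^2 + b%:P) ^+ k)`_2 = k%:R * a * b ^+ k.-1.
Proof.
suff [] : ((a *: 'X^2 + b%:P) ^+ k)`_0 = b ^+ k /\
  ((a *: 'X^2 + b%:P) ^+ k)`_2 = k%:R * a * b ^+ k.-1 by [].
elim: k => [|k [IH0 IH2]]; first by rewrite expr0 !coefC !mul0r.
rewrite exprS mulrDl -scalerAl !coefD !coefZ !coefXnM/= !coefCM IH0 IH2.
split; first by rewrite mulr0 add0r exprS.
by case: k {IH0 IH2} => [|k] /=; rewrite ?expr0 -?natr1 ?exprS; ring.
Qed.

Lemma dfactS (R : realType) k : dfact R k.+1 = k.*2.+1%:R * dfact R k.
Proof. by rewrite /dfact big_ord_recr/= mulrC. Qed.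

Section GaussianSpace.
Context {d : measure_display} {T : measurableType d} {R : realType}.
Variable P : probability T R.
Implicit Types f g h : T -> R.

(** Closure under combinations matters because [gspace_even] is applied to a whole family g + c f,
    polynomially in c. *)
Record gaussian_space (H : set (T -> R)) : Prop := {
  gspace_moments : forall f, H f -> has_moments P f ;
  gspace_comb : forall a b f g, H f -> H g -> H (fun w => a * f w + b * g w) ;
  gspace_even : forall f k, H f ->
    Ex P (fun w => f w ^+ k.*2) = dfact R k * Ex P (fun w => f w ^+ 2) ^+ k }.

Variables (H : set (T -> R)) (HG : gaussian_space H).

(** E (g + c f)^(2k+2) is a polynomial in c in two ways: by the binomial formula, and as dfact (k+1)
    (v + u c^2)^(k+1), since the cross term vanishes. The coefficients of c^2 are compared. *)
Lemma Ex_sqr_even f g k : H f -> H g -> Ex P (fun w => f w * g w) = 0 ->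
  Ex P (fun w => f w ^+ 2 * g w ^+ k.*2) =
  Ex P (fun w => f w ^+ 2) * Ex P (fun w => g w ^+ k.*2).
Proof.
move=> Hf Hg fg0; have mf := gspace_moments HG Hf; have mg := gspace_moments HG Hg.
pose n := k.+1.*2; pose u := Ex P (fun w => f w ^+ 2); pose v := Ex P (fun w => g w ^+ 2).
pose p : {poly R} := \poly_(i < n.+1) ('C(n, i)%:R * Ex P (fun w => g w ^+ (n - i) * f w ^+ i)).
pose q : {poly R} := dfact R k.+1 *: (u *: 'X^2 + v%:P) ^+ k.+1.
have mgf i j : has_moments P (fun w => g w ^+ i * f w ^+ j).
  by apply: has_momentsM; exact: has_momentsX.
have pq : p = q.
  apply: poly_eq_horner => c; rewrite horner_poly hornerZ horner_exp.
  rewrite hornerD hornerZ hornerXn hornerC.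
  transitivity (Ex P (fun w => (1 * g w + c * f w) ^+ n)).
    under [X in Ex P X]eq_fun do rewrite mul1r exprDn.
    rewrite Ex_sum => [|i]; last first.
      under [X in has_moments _ X]eq_fun do rewrite exprMn mulrCA -mulr_natl mulrA.
      exact: has_momentsZ.
    apply: eq_bigr => i _.
    under [X in _ = Ex P X]eq_fun do rewrite exprMn mulrCA -mulr_natl mulrA.
    by rewrite ExZ//; ring.
  rewrite (gspace_even HG); last exact: gspace_comb.
  congr (_ * _ ^+ _).
  transitivity (Ex P (fun w => c ^+ 2 * f w ^+ 2 + (2 * c * (f w * g w) + g w ^+ 2))).
    by congr Ex; apply/funext => w; ring.
  have mfg : has_moments P (fun w => f w * g w) by exact: has_momentsM.
  have mf2 : has_moments P (fun w => f w ^+ 2) by exact: has_momentsX.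
  have mg2 : has_moments P (fun w => g w ^+ 2) by exact: has_momentsX.
  rewrite !ExD ?ExZ//; [|exact: has_momentsZ|exact: has_momentsZ|].
    by rewrite fg0 /u /v; ring.
  by apply: has_momentsD => //; exact: has_momentsZ.
have := congr1 (fun r : {poly R} => r`_2) pq.
rewrite coef_poly coefZ coef2_binomial/= (gspace_even HG)// -/u -/v dfactS.
rewrite (_ : (n - 2)%N = k.*2); last by rewrite /n doubleS; lia.
(* The common factor (k + 1)(2k + 1) appears on the right from the power k + 1 and from [dfactS],
   and cancels. *)
rewrite (_ : 'C(n, 2) = (k.+1 * k.*2.+1)%N); last by rewrite /n bin2 doubleS; lia.
rewrite natrM; under [X in Ex P X]eq_fun do rewrite mulrC.
have k0 : k.+1%:R * k.*2.+1%:R != 0 :> R by rewrite mulf_neq0 ?pnatr_eq0.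
by move=> e; apply: (mulfI k0); rewrite e; ring.
Qed.

Variables (Z : T -> R) (HZ : H Z) (Z1 : Ex P (fun w => Z w ^+ 2) = 1).

Let W w := Z w ^+ 2 - 1.

Let orth f := H f /\ Ex P (fun w => Z w * f w) = 0.

(** Orthogonality to W = Z^2 - 1: a linear space containing the even powers of every variable
    uncorrelated with Z. *)
Let centered f := has_moments P f /\ Ex P (fun w => W w * f w) = 0.

Let mZ : has_moments P Z. Proof. exact: (gspace_moments HG HZ). Qed.

Let mW : has_moments P W.
Proof. by apply: has_momentsB; [exact: has_momentsX|exact: has_moments_cst]. Qed.

Let orth_comb a b f g : orth f -> orth g -> orth (fun w => a * f w + b * g w).
Proof.
move=> [Hf f0] [Hg g0]; split; first exact: gspace_comb.
have mf := gspace_moments HG Hf; have mg := gspace_moments HG Hg.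
transitivity (Ex P (fun w => a * (Z w * f w) + b * (Z w * g w))).
  by congr Ex; apply/funext => w; ring.
have mZf : has_moments P (fun w => Z w * f w) by exact: has_momentsM.
have mZg : has_moments P (fun w => Z w * g w) by exact: has_momentsM.
by rewrite ExD ?ExZ ?f0 ?g0 ?mulr0 ?addr0//; exact: has_momentsZ.
Qed.

Let orthD f g : orth f -> orth g -> orth (fun w => f w + g w).
Proof.
move=> Of Og; have := orth_comb 1 1 Of Og.
by under [X in orth X]eq_fun do rewrite !mul1r.
Qed.

Let orthB f g : orth f -> orth g -> orth (fun w => f w - g w).
Proof.
move=> Of Og; have := orth_comb 1 (- 1) Of Og.
by under [X in orth X]eq_fun do rewrite !mul1r mulN1r.
Qed.

Let centeredD f g : centered f -> centered g -> centered (fun w => f w + g w).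
Proof.
move=> [mf f0] [mg g0]; split; first exact: has_momentsD.
under [X in Ex P X]eq_fun do rewrite mulrDr.
by rewrite ExD ?f0 ?g0 ?addr0//; exact: has_momentsM.
Qed.

Let centeredZ a f : centered f -> centered (fun w => a * f w).
Proof.
move=> [mf f0]; split; first exact: has_momentsZ.
under [X in Ex P X]eq_fun do rewrite mulrCA.
by rewrite ExZ ?f0 ?mulr0//; exact: has_momentsM.
Qed.

Let centeredB f g : centered f -> centered g -> centered (fun w => f w - g w).
Proof.
move=> cf cg; have := centeredD cf (centeredZ (- 1) cg).
by under [X in centered X]eq_fun do rewrite mulN1r.
Qed.

Let centered_even f k : orth f -> centered (fun w => f w ^+ k.*2).
Proof.
move=> [Hf f0]; have mf := gspace_moments HG Hf.
have mfk : has_moments P (fun w => f w ^+ k.*2) by exact: has_momentsX.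
split => //.
under [X in Ex P X]eq_fun do rewrite mulrBl mul1r.
rewrite ExB//; first by rewrite Ex_sqr_even// Z1 mul1r subrr.
by apply: has_momentsM => //; exact: has_momentsX.
Qed.

Let centered4 f : orth f -> centered (fun w => f w ^+ 4).
Proof. exact: (@centered_even f 2). Qed.

Let centered6 f : orth f -> centered (fun w => f w ^+ 6).
Proof. exact: (@centered_even f 3). Qed.

(* Products of squares are combinations of even powers (polarization). *)
Let centered_sqr2 f g : orth f -> orth g -> centered (fun w => f w ^+ 2 * g w ^+ 2).
Proof.
move=> Of Og.
have := centeredZ 12^-1 (centeredB
  (centeredD (centered4 (orthD Of Og)) (centered4 (orthB Of Og)))
  (centeredZ 2 (centeredD (centered4 Of) (centered4 Og)))).
by congr centered; apply/funext => w; field.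
Qed.

(** Inclusion-exclusion on sixth powers: the four sign choices of f + g + h, minus the pairs, plus
    the single terms, leave 4 * 90 = 360 times the product, where 90 = 6!/(2! 2! 2!). *)
Let centered_sqr3 f g h : orth f -> orth g -> orth h ->
  centered (fun w => f w ^+ 2 * g w ^+ 2 * h w ^+ 2).
Proof.
move=> Of Og Oh.
have s4 := centeredD
  (centeredD (centered6 (orthD (orthD Of Og) Oh)) (centered6 (orthB (orthD Of Og) Oh)))
  (centeredD (centered6 (orthD (orthB Of Og) Oh)) (centered6 (orthB (orthB Of Og) Oh))).
have pair f1 f2 : orth f1 -> orth f2 ->
    centered (fun w => (f1 w + f2 w) ^+ 6 + (f1 w - f2 w) ^+ 6).
  by move=> O1 O2; apply: centeredD; apply: centered6; [exact: orthD|exact: orthB].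
have s2 := centeredZ 2 (centeredD (centeredD (pair _ _ Of Og) (pair _ _ Of Oh)) (pair _ _ Og Oh)).
have s1 := centeredZ 4 (centeredD (centeredD (centered6 Of) (centered6 Og)) (centered6 Oh)).
have := centeredZ 360^-1 (centeredD (centeredB s4 s2) s1).
by congr centered; apply/funext => w; field.
Qed.

(** The product expands into products of at most three squares, each orthogonal to W. The variables
    f, g, h may coincide, as they do among the terms of a fourth power. *)
Lemma Ex_sqr_sub1_prod f g h : H f -> H g -> H h ->
  Ex P (fun w => Z w * f w) = 0 -> Ex P (fun w => Z w * g w) = 0 ->
  Ex P (fun w => Z w * h w) = 0 ->
  Ex P (fun w => (Z w ^+ 2 - 1) * ((f w ^+ 2 - 1) * (g w ^+ 2 - 1) * (h w ^+ 2 - 1))) = 0.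
Proof.
move=> Hf Hg Hh f0 g0 h0.
have Of : orth f by []. have Og : orth g by []. have Oh : orth h by [].
have c2 := centered_even 1.
have c0 := centered_even 0 Of.
have [_] := centeredB (centeredD (centeredB (centered_sqr3 Of Og Oh)
  (centeredD (centeredD (centered_sqr2 Of Og) (centered_sqr2 Of Oh)) (centered_sqr2 Og Oh)))
  (centeredD (centeredD (c2 _ Of) (c2 _ Og)) (c2 _ Oh))) c0.
by move=> <-; congr Ex; apply/funext => w; rewrite /W; ring.
Qed.

End GaussianSpace.

(** * Fourth moment of a sum without isolated mixed moments *)

Section FourthMoment.
Context {d : measure_display} {T : measurableType d} {R : realType}.
Variable P : probability T R.
Variables (I : eqType) (W : I -> T -> R) (C : R).
Hypothesis mW : forall i, has_moments P (W i).
Hypothesis W4 : forall i, Ex P (fun w => W i w ^+ 4) <= C.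

Let S r w := \sum_(i <- r) W i w.

Let mS r : has_moments P (S r). Proof. exact: has_moments_sum. Qed.

Let Ex_mul_sum0 f r : has_moments P f ->
  {in r, forall i, Ex P (fun w => f w * W i w) = 0} ->
  Ex P (fun w => f w * S r w) = 0.
Proof.
move=> mf; under [X in Ex P X]eq_fun do rewrite mulr_sumr.
move=> f0; rewrite Ex_sum => [|i]; last exact: has_momentsM.
by rewrite big_seq big1.
Qed.

(** The substitute for independence: in the expansion of a fourth power, a term in which some index
    occurs exactly once has mean zero. *)
Definition uncorrelated4 (r : seq I) := forall i j k l : I, i \in r -> j \in r ->
  k \in r -> l \in r -> i != j -> i != k -> i != l ->
  Ex P (fun w => W i w * (W j w * W k w * W l w)) = 0.

Let C_ge0 (i : I) : 0 <= C.
Proof.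
apply: le_trans (W4 i); apply: Ex_ge0 => w.
by rewrite (exprM _ 2 2) sqr_ge0.
Qed.

Let Ex_sqr_sqr i j : Ex P (fun w => W i w ^+ 2 * W j w ^+ 2) <= C.
Proof.
have m4 k : has_moments P (fun w => W k w ^+ 4) by exact: has_momentsX.
apply: (@le_trans _ _ (Ex P (fun w => 2^-1 * (W i w ^+ 4 + W j w ^+ 4)))).
  apply: Ex_le.
  - by apply: has_momentsM; exact: has_momentsX.
  - by apply: has_momentsZ; exact: has_momentsD.
  - by move=> w; have := sqr_ge0 (W i w ^+ 2 - W j w ^+ 2); lra.
rewrite ExZ ?ExD//; last exact: has_momentsD.
by have := W4 i; have := W4 j; lra.
Qed.

(** When j joins r, the cross term contains [W j] exactly once and vanishes; only a diagonal term,
    at most C, is added. *)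
Let Ex_sqr_sum i r : uniq (i :: r) -> uncorrelated4 (i :: r) ->
  Ex P (fun w => W i w ^+ 2 * S r w ^+ 2) <= C * (size r)%:R.
Proof.
elim: r => [|j r IH] /=.
  move=> _ _; rewrite mulr0; under [X in Ex P X]eq_fun do rewrite /S big_nil expr0n mulr0.
  by rewrite Ex_cst.
rewrite inE negb_or => /and3P[/andP[ij ir] jr ur] unc.
have m2 k : has_moments P (fun w => W k w ^+ 2) by exact: has_momentsX.
have mij : has_moments P (fun w => W i w ^+ 2 * W j w ^+ 2) by exact: has_momentsM.
have mS2 : has_moments P (fun w => W i w ^+ 2 * S r w ^+ 2).
  by apply: has_momentsM => //; exact: has_momentsX.
have mf : has_moments P (fun w => W i w ^+ 2 * W j w) by exact: has_momentsM.
have mx : has_moments P (fun w => W i w ^+ 2 * W j w * S r w) by exact: has_momentsM.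
have -> : (fun w => W i w ^+ 2 * S (j :: r) w ^+ 2) = (fun w => W i w ^+ 2 * W j w ^+ 2 +
    (2 * (W i w ^+ 2 * W j w * S r w) + W i w ^+ 2 * S r w ^+ 2)).
  by apply/funext => w; rewrite /S big_cons; ring.
rewrite !ExD ?ExZ//; [|exact: has_momentsZ|]; last first.
  by apply: has_momentsD => //; exact: has_momentsZ.
rewrite Ex_mul_sum0//; last first.
  move=> k kr; rewrite -[RHS](unc j i i k) ?inE ?eqxx ?kr ?orbT//.
  - by congr Ex; apply/funext => w; ring.
  - by rewrite eq_sym.
  - by rewrite eq_sym.
  - by apply: contraNneq jr => ->.
have := Ex_sqr_sqr i j; have := IH; rewrite /= ir ur => /(_ isT).
have unc' : uncorrelated4 (i :: r).
  have sub x : x \in i :: r -> x \in [:: i, j & r].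
    by rewrite !inE => /orP[->|->]; rewrite ?orbT.
  by move=> a b c e ar br cr er; apply: unc; exact: sub.
by move=> /(_ unc'); rewrite -natr1; lra.
Qed.

(** Adding i contributes at most 4 C + 8 C (size r), exactly the increment of 4 C (size r)^2; the
    term linear in [W i] has mean zero. *)
Lemma fourth_moment_sum r : uniq r -> uncorrelated4 r ->
  Ex P (fun w => (\sum_(i <- r) W i w) ^+ 4) <= 4 * C * (size r)%:R ^+ 2.
Proof.
rewrite -/(S r); elim: r => [|i r IH].
  move=> _ _; under [X in Ex P X]eq_fun do rewrite big_nil expr0n.
  by rewrite Ex_cst expr0n mulr0.
move=> uir unc; have /= /andP[ir ur] := uir.
have unc' : uncorrelated4 r.
  by move=> a b c e ar br cr er; apply: unc; rewrite inE ?ar ?br ?cr ?er orbT.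
have /(_ ur unc') {}IH := IH.
have m4 : has_moments P (fun w => W i w ^+ 4) by exact: has_momentsX.
have mS4 : has_moments P (fun w => S r w ^+ 4) by exact: has_momentsX.
have m22 : has_moments P (fun w => W i w ^+ 2 * S r w ^+ 2).
  by apply: has_momentsM; exact: has_momentsX.
have m13 : has_moments P (fun w => W i w * S r w * S r w * S r w).
  by do 3! apply: has_momentsM => //.
have -> : 4 * C * (size (i :: r))%:R ^+ 2 =
   3 * C + (8 * (C * (size r)%:R) + (4 * C * (size r)%:R ^+ 2 + C)).
  by rewrite /= -natr1; ring.
(* The term 4 W^3 S is absorbed by 4 W^3 S <= 2 W^4 + 2 W^2 S^2, turning the coefficients 1 and 6
   into 3 and 8. *)
apply: (@le_trans _ _ (Ex P (fun w => 3 * W i w ^+ 4 + (8 * (W i w ^+ 2 * S r w ^+ 2) +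
    (S r w ^+ 4 + 4 * (W i w * S r w * S r w * S r w)))))).
  apply: Ex_le.
  - by apply: has_momentsX; exact: (mS (i :: r)).
  - by do 3?[apply: has_momentsD]; rewrite //; exact: has_momentsZ.
  - move=> w; rewrite big_cons -/(S r w).
    have := sqr_ge0 (W i w ^+ 2 - W i w * S r w).
    by lra.
rewrite !ExD ?ExZ//; do ?[exact: has_momentsZ]; last first.
  by do 2?[apply: has_momentsD]; rewrite //; exact: has_momentsZ.
  by do 2?[apply: has_momentsD]; rewrite //; exact: has_momentsZ.
rewrite (_ : Ex P (fun w => W i w * S r w * S r w * S r w) = 0).
  by have := W4 i; have := Ex_sqr_sum uir unc; have := C_ge0 i; lra.
apply: Ex_mul_sum0; first by do 2! apply: has_momentsM => //.
move=> l lr; under [X in Ex P X]eq_fun do rewrite mulrAC.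
apply: Ex_mul_sum0; first by do 2! apply: has_momentsM => //.
move=> k kr; rewrite (_ : (fun w => _) = (fun w => (W i w * W l w * W k w) * S r w)).
  apply: Ex_mul_sum0; first by do 2! apply: has_momentsM => //.
  move=> j jr; rewrite -[RHS](unc i j k l) ?inE ?eqxx ?jr ?kr ?lr ?orbT//.
  - by congr Ex; apply/funext => w; ring.
  - by apply: contraNneq ir => ->.
  - by apply: contraNneq ir => ->.
  - by apply: contraNneq ir => ->.
by apply/funext => w; ring.
Qed.

End FourthMoment.

(** * The prediction errors of the observed process *)

Lemma dfact2 (R : realType) : dfact R 2 = 3.
Proof. by rewrite /dfact 2!big_ord_recr big_ord0/= !mul1r. Qed.

Section ObservedProcess.
Context {d : measure_display} {T : measurableType d} {R : realType}.
Variables (P : probability T R) (theta0 sigma02 : R) (Y : R -> {RV P >-> R}).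
Hypotheses (theta0_gt0 : 0 < theta0) (sigma02_gt0 : 0 < sigma02).
Hypothesis Y_gaussian : centered_gaussian_process `[0, 1] Y
  (fun t1 t2 => sigma02 * exp_corr theta0 t1 t2).

Lemma process_moments t : 0 <= t <= 1 ->
  has_moments P (Y t) /\ Ex P (Y t) = 0.
Proof.
move=> t01; case: Y_gaussian => gY mean0 _.
have It : `[0, 1]%classic t by rewrite /= in_itv.
have EY : (\int[P]_w (Y t w)%:E = 0)%E by rewrite -expectation_def mean0.
have mY : measurable_fun setT (Y t) by exact: measurable_funP.
have [] := @gaussian_law_moments _ _ _ P (Y t) mY EY.
  have := gY 1%N (fun=> t) (fun=> 1) (fun=> It).
  rewrite (_ : (fun w => \sum_(i < 1) _) = Y t)//.
  by apply/funext => w; rewrite big_ord1 mul1r.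
move=> HY _; split => //; apply: EFin_inj.
by rewrite -EFin_Ex.
Qed.

Lemma process_cov t1 t2 : 0 <= t1 <= 1 -> 0 <= t2 <= 1 ->
  Ex P (fun w => Y t1 w * Y t2 w) = sigma02 * exp_corr theta0 t1 t2.
Proof.
move=> I1 I2; case: Y_gaussian => _ mean0 cov.
have [m1 _] := process_moments I1; have [m2 _] := process_moments I2.
apply: EFin_inj; rewrite -EFin_Ex; last exact: has_momentsM.
rewrite -cov/= ?in_itv//= covariance.unlock !mean0/= ?in_itv//=.
rewrite expectation.unlock; apply: eq_integral => w _.
by transitivity ((Y t1 w - 0) * (Y t2 w - 0))%:E; first by rewrite !subr0.
Qed.

Variables (n : nat) (s : 'I_n -> R).
Hypotheses (n_ge2 : (2 <= n)%N) (s_design : is_design s).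

Let s01 i : 0 <= s i <= 1. Proof. exact: design_itv. Qed.
Let s_incr : strictly_increasing s. Proof. exact: design_incr. Qed.

Definition obs (w : T) (i : 'I_n) : R := Y (s i) w.

Definition obs_comb (c : 'I_n -> R) (w : T) : R := \sum_i c i * obs w i.

Let mY i : has_moments P (fun w => obs w i).
Proof. by case: (process_moments (s01 i)). Qed.

Lemma obs_gaussian_space : gaussian_space P (range obs_comb).
Proof.
have m_comb c : has_moments P (obs_comb c).
  by apply: has_moments_sum => i; exact: has_momentsZ.
split.
- by move=> _ [c _ <-]; exact: m_comb.
- move=> a b _ _ [c1 _ <-] [c2 _ <-]; exists (fun i => a * c1 i + b * c2 i) => //.
  apply/funext => w; rewrite /obs_comb !mulr_sumr -big_split/=.
  by apply: eq_bigr => i _; ring.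
- move=> _ k [c _ <-].
  have [mc _] := m_comb c.
  have E0 : (\int[P]_w (obs_comb c w)%:E = 0)%E.
    rewrite EFin_Ex// /obs_comb Ex_sum => [|i]; last exact: has_momentsZ.
    by rewrite big1// => i _; rewrite ExZ// (process_moments (s01 i)).2 mulr0.
  have [|_ ->] // := gaussian_law_moments mc E0.
  case: Y_gaussian => gY _ _; apply: gY => i.
  by rewrite /= in_itv/= s01.
Qed.

Lemma obs_in_space i : range obs_comb (fun w => obs w i).
Proof.
exists (fun j => (j == i)%:R) => //; apply/funext => w.
rewrite /obs_comb (bigD1 i)//= eqxx mul1r big1 ?addr0// => j /negbTE ->.
by rewrite mul0r.
Qed.

Definition loo_err (i : 'I_n) (w : T) : R := obs w i - nbr_mean theta0 s (obs w) i.

Let m_err i : has_moments P (loo_err i).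
Proof.
by apply: has_momentsB => //; apply: has_momentsD; exact: has_momentsZ.
Qed.

(** [nbr_mean_corr] read as a covariance: a prediction error is orthogonal to every observation
    other than its own. *)
Lemma Ex_loo_err_obs i k :
  Ex P (fun w => loo_err i w * obs w k)
  = sigma02 * ((k == i)%:R * nbr_var theta0 s i).
Proof.
have mYY j : has_moments P (fun w => obs w j * obs w k) by exact: has_momentsM.
transitivity (Ex P (fun w => obs w i * obs w k -
   (left_weight theta0 s i * (obs w (ord_pred i) * obs w k)
    + right_weight theta0 s i * (obs w (ordS i) * obs w k)))).
  by congr Ex; apply/funext => w; rewrite /loo_err /nbr_mean; ring.
rewrite ExB ?ExD ?ExZ//; [|exact: has_momentsZ..|]; last first.
  by apply: has_momentsD; exact: has_momentsZ.
rewrite !process_cov//.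
have := nbr_mean_corr theta0_gt0 s_incr i k; rewrite /nbr_mean.
move: (nbr_var _ _ _) (left_weight _ _ _) (right_weight _ _ _) => V a b.
by move=> /(congr1 (fun z => sigma02 * z)); lra.
Qed.

Lemma left_weight_eq0 (i : 'I_n) : i = 0%N :> nat -> left_weight theta0 s i = 0.
Proof. by move=> i0; rewrite /left_weight /left_corr i0 eqxx /pred_weight !mul0r. Qed.

Lemma right_weight_eq0 (i : 'I_n) : i.+1 = n -> right_weight theta0 s i = 0.
Proof. by move=> i1; rewrite /right_weight /right_corr i1 eqxx /pred_weight !mul0r. Qed.

(** The error at j involves [obs w j] and observations at indices of the other parity, to which the
    error at i is orthogonal. A wrapped neighbour may break the parity, but its weight is 0. *)
Lemma Ex_loo_err (i j : 'I_n) : odd i = odd j ->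
  Ex P (fun w => loo_err i w * loo_err j w)
  = sigma02 * ((i == j)%:R * nbr_var theta0 s i).
Proof.
move=> ij.
have mEY k : has_moments P (fun w => loo_err i w * obs w k) by exact: has_momentsM.
transitivity (Ex P (fun w => loo_err i w * obs w j -
   (left_weight theta0 s j * (loo_err i w * obs w (ord_pred j))
    + right_weight theta0 s j * (loo_err i w * obs w (ordS j))))).
  by congr Ex; apply/funext => w; rewrite {2}/loo_err /nbr_mean; ring.
rewrite ExB ?ExD ?ExZ//; [|exact: has_momentsZ..|]; last first.
  by apply: has_momentsD; exact: has_momentsZ.
rewrite !Ex_loo_err_obs (eq_sym i).
have -> : left_weight theta0 s j * (sigma02 * ((ord_pred j == i)%:R * nbr_var theta0 s i)) = 0.
  have [j0|j0] := eqVneq (j : nat) 0%N; first by rewrite left_weight_eq0 ?mul0r.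
  rewrite (negbTE (_ : ord_pred j != i)) ?mul0r ?mulr0//.
  by apply: contra_eqN ij => /eqP <-; rewrite ord_predE//; lia.
have -> : right_weight theta0 s j * (sigma02 * ((ordS j == i)%:R * nbr_var theta0 s i)) = 0.
  have [j0|j0] := eqVneq j.+1 n; first by rewrite right_weight_eq0 ?mul0r.
  rewrite (negbTE (_ : ordS j != i)) ?mul0r ?mulr0//.
  by apply: contra_eqN ij => /eqP <-; rewrite ordSE//=; lia.
by rewrite addr0 subr0.
Qed.

Let sd i := Num.sqrt (sigma02 * nbr_var theta0 s i).

Let v_gt0 i : 0 < nbr_var theta0 s i. Proof. exact: nbr_var_gt0. Qed.

Let Z i w := (sd i)^-1 * loo_err i w.

Let Z2 i w : Z i w ^+ 2 = std_err2 theta0 s (obs w) i / sigma02.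
Proof.
rewrite /Z exprMn exprVn sqr_sqrtr ?(ltW (mulr_gt0 _ (v_gt0 i)))// /std_err2 -/(loo_err i w).
by move: (nbr_var _ _ _) (v_gt0 i) => V v0; field; rewrite !gt_eqF.
Qed.

Let HZ i : range obs_comb (Z i).
Proof.
have HG := obs_gaussian_space; have HY := obs_in_space.
have H1 := gspace_comb HG (- left_weight theta0 s i) (- right_weight theta0 s i)
  (HY (ord_pred i)) (HY (ordS i)).
have := gspace_comb HG (sd i)^-1 (sd i)^-1 (HY i) H1.
have -> // : (fun w => (sd i)^-1 * obs w i + (sd i)^-1 *
    (- left_weight theta0 s i * obs w (ord_pred i) +
     - right_weight theta0 s i * obs w (ordS i))) = Z i.
by apply/funext => w; rewrite /Z /loo_err /nbr_mean; ring.
Qed.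

Let mZ i : has_moments P (Z i).
Proof. exact: (gspace_moments obs_gaussian_space (HZ i)). Qed.

Let Ex_ZZ (i j : 'I_n) : odd i = odd j -> Ex P (fun w => Z i w * Z j w) = (i == j)%:R.
Proof.
move=> ij.
transitivity (Ex P (fun w => ((sd i)^-1 * (sd j)^-1) * (loo_err i w * loo_err j w))).
  by congr Ex; apply/funext => w; rewrite /Z; ring.
rewrite ExZ ?Ex_loo_err//; last exact: has_momentsM.
have [<-|_] := eqVneq i j; last by rewrite mul0r !mulr0.
rewrite mul1r -invfM -expr2 sqr_sqrtr ?(ltW (mulr_gt0 _ (v_gt0 i)))//.
by rewrite mulVf// gt_eqF// mulr_gt0.
Qed.

Let Ex_Z2 i : Ex P (fun w => Z i w ^+ 2) = 1.
Proof.
have := Ex_ZZ (erefl (odd i)); rewrite eqxx mulr1n => <-.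
by congr Ex; apply/funext => w; rewrite expr2.
Qed.

Let W i w := Z i w ^+ 2 - 1.

Let mW i : has_moments P (W i).
Proof. by apply: has_momentsB; [exact: has_momentsX|exact: has_moments_cst]. Qed.

Let Ex_Z_even i k : Ex P (fun w => Z i w ^+ k.*2) = dfact R k.
Proof. by rewrite (gspace_even obs_gaussian_space k (HZ i)) Ex_Z2 expr1n mulr1. Qed.

(** With u = Z^2 >= 0 one has (u - 1)^4 <= u^4 + 1, and E Z^8 = dfact 4. *)
Let W4 i : Ex P (fun w => W i w ^+ 4) <= dfact R 4 + 1.
Proof.
rewrite -(Ex_Z_even i) -[X in _ <= _ + X](Ex_cst P) -ExD; last 2 first.
- exact: has_momentsX.
- exact: has_moments_cst.
apply: Ex_le.
- exact: has_momentsX.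
- by apply: has_momentsD; [exact: has_momentsX|exact: has_moments_cst].
- move=> w; rewrite /W -mul2n exprM; have := sqr_ge0 (Z i w).
  move: (Z i w ^+ 2) => u u0.
  have : 0 <= u * (u - 1) ^+ 2 by rewrite mulr_ge0 ?sqr_ge0.
  have : 0 <= u * u ^+ 2 by rewrite mulr_ge0 ?sqr_ge0.
  by lra.
Qed.

(** Within a parity class the Z are pairwise uncorrelated, and [Ex_sqr_sub1_prod] upgrades this to
    [uncorrelated4]. *)
Let parity_sum (b : bool) :
  Ex P (fun w => (\sum_(i <- [seq i : 'I_n <- enum 'I_n | odd i == b]) W i w) ^+ 4)
  <= 4 * (dfact R 4 + 1) * n%:R ^+ 2.
Proof.
set r := [seq _ <- _ | _].
have rb i : i \in r -> odd i = b by rewrite mem_filter => /andP[/eqP].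
have ur : uniq r by rewrite filter_uniq// enum_uniq.
apply: le_trans (fourth_moment_sum mW W4 ur _) _.
  move=> i j k l ir jr kr lr ij ik il.
  apply: (Ex_sqr_sub1_prod obs_gaussian_space) => //; rewrite Ex_ZZ ?rb//.
  - by rewrite (negbTE ij).
  - by rewrite (negbTE ik).
  - by rewrite (negbTE il).
rewrite ler_wpM2l//; first by rewrite mulr_ge0// addr_ge0// prodr_ge0.
rewrite lerXn2r ?nnegrE// ler_nat size_filter.
by apply: leq_trans (count_size _ _) _; rewrite size_enum_ord.
Qed.

Lemma has_moments_std_err2 i : has_moments P (fun w => std_err2 theta0 s (obs w) i).
Proof.
have := has_momentsZ sigma02 (has_momentsX 2 (mZ i)).
by congr has_moments; apply/funext => w; rewrite Z2 mulrC divfK ?gt_eqF.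
Qed.

Lemma has_moments_total_err : has_moments P (fun w => total_err theta0 s (obs w)).
Proof. by apply: has_moments_sum => i; exact: has_moments_std_err2. Qed.

Definition centered_total_err (w : T) : R :=
  total_err theta0 s (obs w) / sigma02 - n%:R.

Lemma has_moments_centered_total_err : has_moments P centered_total_err.
Proof.
apply: has_momentsB; last exact: has_moments_cst.
by apply: has_momentsM; [exact: has_moments_total_err|exact: has_moments_cst].
Qed.

(* Prediction errors at indices of equal parity are uncorrelated. *)
Lemma Ex_centered_total_err4 :
  Ex P (fun w => centered_total_err w ^+ 4) <= 64 * (dfact R 4 + 1) * n%:R ^+ 2.
Proof.
pose S b w := \sum_(i <- [seq i : 'I_n <- enum 'I_n | odd i == b]) W i w.
have mS b : has_moments P (S b) by exact: has_moments_sum.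
have E w : centered_total_err w = S true w + S false w.
  transitivity (\sum_(i < n) W i w).
    rewrite /W sumrB /centered_total_err /total_err mulr_suml; congr (_ - _).
      by apply: eq_bigr => i _; rewrite Z2.
    by rewrite sumr_const card_ord.
  rewrite (bigID (fun i : 'I_n => odd i == true))/= /S !big_filter !big_enum_cond/=.
  by congr (_ + _); apply: eq_bigl => i; case: (odd i).
(* By (x + y)^4 <= 8 (x^4 + y^4); two classes with constant 4 each give 64. *)
apply: (@le_trans _ _ (Ex P (fun w => 8 * (S true w ^+ 4 + S false w ^+ 4)))).
  apply: Ex_le.
  - by apply: has_momentsX; exact: has_moments_centered_total_err.
  - by apply: has_momentsZ; apply: has_momentsD; exact: has_momentsX.
  - move=> w; rewrite E; move: (S true w) (S false w) => x y.
    have := ler_sqrD x y; have := ler_sqrD (x ^+ 2) (y ^+ 2).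
    rewrite -!exprM => h1 h2.
    have : ((x + y) ^+ 2) ^+ 2 <= (2 * (x ^+ 2 + y ^+ 2)) ^+ 2.
      by rewrite lerXn2r ?nnegrE ?sqr_ge0// mulr_ge0// addr_ge0 ?sqr_ge0.
    by rewrite -exprM exprMn; lra.
rewrite ExZ ?ExD; [|exact: has_momentsX..|]; last first.
  by apply: has_momentsD; exact: has_momentsX.
have := parity_sum true; have := parity_sum false; rewrite -/(S true) -/(S false).
by lra.
Qed.

Let Y4 i : Ex P (fun w => obs w i ^+ 4) = 3 * sigma02 ^+ 2.
Proof.
rewrite (gspace_even obs_gaussian_space 2 (obs_in_space i)).
rewrite (process_cov (s01 i) (s01 i)) /exp_corr subrr normr0 mulr0 expR0 mulr1.
by rewrite dfact2.
Qed.

Lemma has_moments_weighted_err : has_moments P (fun w => weighted_err theta0 s (obs w)).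
Proof.
apply: has_moments_sum => i; apply: has_momentsZ; apply: has_momentsD.
  exact: has_moments_std_err2.
by apply: has_momentsD; exact: has_momentsX.
Qed.

(** Cauchy-Schwarz for the weights l_i, of total mass at most 2, bounds the square by 2 times the
    weighted sum of G_i^2. Each E G_i^2 is at most 3 (3 + 3 + 3) [sigma02 ^+ 2], three fourth
    moments; 108 = 2 * 2 * 27. *)
Lemma Ex_weighted_err2 :
  Ex P (fun w => weighted_err theta0 s (obs w) ^+ 2) <= 108 * sigma02 ^+ 2.
Proof.
pose l := nbr_len s; pose G i w := std_err2 theta0 s (obs w) i + nbr_sqr (obs w) i.
have l0 i : 0 <= l i by exact: nbr_len_ge0.
have mG i : has_moments P (G i).
  apply: has_momentsD; first exact: has_moments_std_err2.
  by apply: has_momentsD; exact: has_momentsX.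
have mG2 i : has_moments P (fun w => G i w ^+ 2) by exact: has_momentsX.
have G2 i : Ex P (fun w => G i w ^+ 2) <= 27 * sigma02 ^+ 2.
  have mY4 j : has_moments P (fun w => obs w j ^+ 4) by exact: has_momentsX.
  have mZ4 : has_moments P (fun w => sigma02 ^+ 2 * Z i w ^+ 4).
    by apply: has_momentsZ; exact: has_momentsX.
  apply: (@le_trans _ _ (Ex P (fun w => 3 * (sigma02 ^+ 2 * Z i w ^+ 4 +
      (obs w (ord_pred i) ^+ 4 + obs w (ordS i) ^+ 4))))).
    apply: Ex_le => //.
      by apply: has_momentsZ; apply: has_momentsD => //; exact: has_momentsD.
    move=> w; rewrite /G /nbr_sqr.
    have -> : std_err2 theta0 s (obs w) i = sigma02 * Z i w ^+ 2.
      by rewrite Z2 mulrC divfK ?gt_eqF.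
    move: (Z i w) (obs w (ord_pred i)) (obs w (ordS i)) => x y z.
    have -> : 3 * (sigma02 ^+ 2 * x ^+ 4 + (y ^+ 4 + z ^+ 4)) =
      3 * ((sigma02 * x ^+ 2) ^+ 2 + ((y ^+ 2) ^+ 2 + (z ^+ 2) ^+ 2)) by ring.
    move: (sigma02 * x ^+ 2) (y ^+ 2) (z ^+ 2) => {}x {}y {}z.
    have := sqr_ge0 (x - y); have := sqr_ge0 (x - z); have := sqr_ge0 (y - z).
    by lra.
  rewrite ExZ; last by apply: has_momentsD => //; exact: has_momentsD.
  rewrite !ExD//; last exact: has_momentsD.
  rewrite ExZ; last exact: has_momentsX.
  rewrite (Ex_Z_even i 2) !Y4 dfact2.
  by lra.
have lsum : \sum_i l i <= 2 by exact: sum_nbr_len.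
have lsum0 : 0 <= \sum_i l i by exact: sumr_ge0.
apply: (@le_trans _ _ (Ex P (fun w => 2 * \sum_i l i * G i w ^+ 2))).
  apply: Ex_le.
  - by apply: has_momentsX; exact: has_moments_weighted_err.
  - by apply: has_momentsZ; apply: has_moments_sum => i; exact: has_momentsZ.
  - move=> w; rewrite /weighted_err -/l -/(G _ w).
    apply: (@le_trans _ _ ((\sum_i l i) * (\sum_i l i * G i w ^+ 2))); last first.
      rewrite ler_wpM2r// sumr_ge0// => i _.
      by rewrite mulr_ge0// sqr_ge0.
    rewrite expr2 !big_distrlr/=.
    (* Symmetric form of the Cauchy-Schwarz step: G_i G_j <= (G_i^2 + G_j^2) / 2 termwise, and the
       two halves have equal sums. *)
    pose H i j := l i * l j * (2^-1 * (G i w ^+ 2 + G j w ^+ 2)).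
    apply: (@le_trans _ _ (\sum_i \sum_j H i j)).
      apply: ler_sum => i _; apply: ler_sum => j _.
      rewrite /H (_ : _ * _ = l i * l j * (G i w * G j w)); last by rewrite /G; ring.
      rewrite ler_wpM2l ?mulr_ge0//.
      by have := sqr_ge0 (G i w - G j w); lra.
    have -> : \sum_i \sum_j H i j = 2^-1 * (\sum_i \sum_j l i * (l j * G j w ^+ 2)) +
        2^-1 * (\sum_j \sum_i l j * (l i * G i w ^+ 2)).
      rewrite [X in _ + _ * X]exchange_big/= !mulr_sumr -big_split/=.
      apply: eq_bigr => i _; rewrite !mulr_sumr -big_split/=.
      by apply: eq_bigr => j _; rewrite /H; ring.
    by lra.
rewrite ExZ; last by apply: has_moments_sum => i; exact: has_momentsZ.
rewrite Ex_sum; last by move=> i; exact: has_momentsZ.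
under eq_bigr do rewrite ExZ//.
have : \sum_i l i * Ex P (fun w => G i w ^+ 2) <= 2 * (27 * sigma02 ^+ 2).
  apply: (@le_trans _ _ (\sum_i l i * (27 * sigma02 ^+ 2))).
    by apply: ler_sum => i _; rewrite ler_wpM2l.
  by rewrite -mulr_suml ler_wpM2r// mulr_ge0// sqr_ge0.
by lra.
Qed.

End ObservedProcess.

(** * Consistency and existence of the minimizers *)

Lemma sum_inv_sqr_le (R : realType) n :
  \sum_(0 <= k < n) (k.+1%:R ^+ 2)^-1 <= 2 :> R.
Proof.
case: n => [|n]; first by rewrite big_nil.
(* The sharper bound is the one that telescopes, as 1/(x + 1)^2 <= 1/x - 1/(x + 1). *)
suff: \sum_(0 <= k < n.+1) (k.+1%:R ^+ 2)^-1 <= 2 - n.+1%:R^-1 :> R.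
  by move/le_trans; apply; rewrite gerBl invr_ge0.
elim: n => [|n IH]; first by rewrite big_nat1 expr1n invr1; lra.
rewrite big_nat_recr//=; apply: le_trans (lerD IH (lexx _)) _.
have n0 : 0 < n.+1%:R :> R by [].
have -> : (n.+2)%:R = n.+1%:R + 1 :> R by rewrite natr1.
move: (n.+1%:R) n0 => x x0; have x1 : 0 < x + 1 by rewrite ltr_wpDr.
suff: 0 <= x^-1 - (x + 1)^-1 - ((x + 1) ^+ 2)^-1 by lra.
rewrite (_ : _ - _ = (x * (x + 1) ^+ 2)^-1).
  by rewrite invr_ge0 mulr_ge0 ?sqr_ge0// ltW.
by field; rewrite !gt_eqF.
Qed.

(** Integrated term by term, the series of the [f n] has expectation at most 2 C; it converges
    almost surely, so its terms tend to 0, whatever the dependence between different n. *)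
Lemma ae_cvg0 {d : measure_display} {T : measurableType d} {R : realType}
    (P : probability T R) (f : nat -> T -> R) (C : R) :
  (forall n, has_moments P (f n)) -> (forall n w, 0 <= f n w) ->
  (forall n, Ex P (f n) <= C / n.+1%:R ^+ 2) ->
  {ae P, forall w, f n w @[n --> \oo] --> 0}.
Proof.
move=> mf f0 fC.
have mF n : measurable_fun setT (fun w => (f n w)%:E).
  by apply/measurable_EFinP; exact: (mf n).1.
pose F w := (\sum_(n <oo) (f n w)%:E)%E.
have F0 w : (0 <= F w)%E by apply: nneseries_ge0 => n _ _; rewrite lee_fin.
have C0 : 0 <= C.
  by have := le_trans (Ex_ge0 P (f0 0)) (fC 0); rewrite expr1n divr1.
have intF : P.-integrable setT F.
  apply/integrableP; split.
    by apply: ge0_emeasurable_sum => // n w _ _; rewrite lee_fin.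
  under eq_integral do rewrite gee0_abs//.
  rewrite integral_nneseries//; last by move=> n w _; rewrite lee_fin.
  apply: (@le_lt_trans _ _ (C * 2)%:E); last by rewrite ltry.
  apply: lime_le.
    by apply: is_cvg_nneseries => n _ _; apply: integral_ge0 => w _; rewrite lee_fin.
  apply: nearW => n.
  under eq_bigr do rewrite EFin_Ex//.
  rewrite sumEFin lee_fin.
  apply: (@le_trans _ _ (\sum_(0 <= k < n) C * (k.+1%:R ^+ 2)^-1)).
    by apply: ler_sum => k _; exact: fC.
  by rewrite -mulr_sumr ler_wpM2l// sum_inv_sqr_le.
apply: filterS (integrable_ae measurableT intF) => w /(_ I) Fw.
apply: cvg_series_cvg_0; apply: nondecreasing_is_cvgn.
  apply/nondecreasing_seqP => n.
  by rewrite /series/= big_nat_recr//= lerDl.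
exists (fine (F w)) => _ [n _ <-].
rewrite -lee_fin fineK// /series/= -sumEFin.
by apply: nneseries_lim_ge => k _ _; rewrite lee_fin.
Qed.

Lemma cvg0_expr (R : realType) (u : nat -> R) k :
  u n ^+ k.+1 @[n --> \oo] --> 0 -> u n @[n --> \oo] --> 0.
Proof.
move=> /cvgr0Pnorm_lt uk; apply/cvgr0Pnorm_lt => e e0.
apply: filterS (uk _ (exprn_gt0 k.+1 e0)) => n.
by rewrite normrX ltr_pXn2r ?nnegrE// ltW.
Qed.

(** With v = sqrt u, ln u = 2 ln v <= 2 (v - 1), and v^2 - 1 - 2 (v - 1) is a square. *)
Lemma sqr_sqrt_sub1_le (R : realType) (u : R) : 0 < u ->
  (Num.sqrt u - 1) ^+ 2 <= u - 1 - ln u.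
Proof.
move=> u0; have v0 : 0 < Num.sqrt u by rewrite sqrtr_gt0.
have uE : u = Num.sqrt u ^+ 2 by rewrite sqr_sqrtr// ltW.
rewrite [in leRHS]uE lnXn//; move: (Num.sqrt u) v0 => v v0.
have := @le_ln1Dx R (v - 1); rewrite addrCA subrr addr0 => /(_ _).
by rewrite ltrBrDl subrr v0 => /(_ isT); rewrite mulr2n; lra.
Qed.

(* After division by [n], the function [n * ln x + theta0 * X n / x] that [x n]
   almost minimizes tends to [ln x + theta0 * sigma02 / x]. The choice
   [eta ^+ 2 = N n / n + 1 / n] balances the two error terms. *)
Lemma argmin_cvg (R : realType) (theta0 sigma02 C b m : R) (x X N : nat -> R) :
  0 < theta0 -> 0 < sigma02 -> 0 < C -> 0 < b -> 0 < m ->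
  X n / n%:R @[n --> \oo] --> sigma02 -> N n / n%:R @[n --> \oo] --> 0 ->
  (forall n, (2 <= n)%N -> 0 <= X n /\ 0 <= N n) ->
  (forall n, (2 <= n)%N -> m <= x n) ->
  (forall n eta, (2 <= n)%N -> 0 < eta <= 1 ->
     n%:R * ln (x n) + theta0 / x n * X n <=
     n%:R * ln (theta0 * sigma02) + theta0 / (theta0 * sigma02) * X n
     + 2 * (C + C / b * (eta * X n + eta^-1 * N n))) ->
  x n @[n --> \oo] --> theta0 * sigma02.
Proof.
move=> t0 s0 C0 b0 m0 Xs N0 XN_ge0 x_ge xmin.
pose tau := theta0 * sigma02; have tau0 : 0 < tau by rewrite mulr_gt0.
pose al n := X n / n%:R; pose be n := N n / n%:R.
(* The summand 1 / n keeps eta positive when [N n] vanishes. *)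
pose eta n := Num.sqrt (be n + n%:R^-1).
have invn : (n%:R^-1 : R) @[n --> \oo] --> 0.
  by rewrite -(cvg_shiftS (fun n => n%:R^-1 : R)); exact: cvg_harmonic.
have eta_cvg : eta n @[n --> \oo] --> 0.
  rewrite -[X in _ --> X](@sqrtr0 R); apply: continuous_cvg.
    exact: sqrt_continuous.
  by rewrite -[X in _ --> X]addr0; apply: cvgD.
(* The first summand is the price of replacing [X n / n] by its limit, the second the remainder
   divided by n. *)
pose e n := theta0 * `|al n - sigma02| * (tau^-1 + m^-1) +
  2 * (C * n%:R^-1 + C / b * (eta n * (al n + 1))).
have e_cvg : e n @[n --> \oo] --> 0.
  rewrite (_ : 0 = theta0 * `|sigma02 - sigma02| * (tau^-1 + m^-1) +
    2 * (C * 0 + C / b * (0 * (sigma02 + 1)))); last first.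
    by rewrite subrr normr0; ring.
  apply: cvgD.
    apply: cvgM; last exact: cvg_cst.
    apply: cvgM; first exact: cvg_cst.
    by apply: cvg_norm; apply: cvgB => //; exact: cvg_cst.
  apply: cvgM; first exact: cvg_cst.
  apply: cvgD; apply: cvgM; try exact: cvg_cst; first exact: invn.
  by apply: cvgM => //; apply: cvgD => //; exact: cvg_cst.
have main : \forall n \near \oo,
    0 <= (Num.sqrt (tau / x n) - 1) ^+ 2 <= e n.
  have eta1 : \forall n \near \oo, eta n < 1.
    by move/cvgr0Pnorm_lt : eta_cvg => /(_ 1 ltr01); apply: filterS => n;
       rewrite ger0_norm ?sqrtr_ge0.
  near=> n; rewrite sqr_ge0/=.
  have n2 : (2 <= n)%N by near: n; exists 2%N.
  have n0 : 0 < n%:R :> R by rewrite ltr0n; lia.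
  have [X0 Nn0] := XN_ge0 _ n2; have mx := x_ge _ n2.
  have x0 : 0 < x n by exact: lt_le_trans mx.
  have be0 : 0 <= be n by rewrite divr_ge0// ltW.
  have bn0 : 0 < be n + n%:R^-1 by rewrite ltr_wpDl// invr_gt0.
  have eta0 : 0 < eta n by rewrite sqrtr_gt0.
  have etaE : eta n ^+ 2 = be n + n%:R^-1 by rewrite sqr_sqrtr// ltW.
  have eta01 : 0 < eta n <= 1 by rewrite eta0 ltW//; near: n.
  have u0 : 0 < tau / x n by rewrite divr_gt0.
  apply: (le_trans (sqr_sqrt_sub1_le u0)).
  have := xmin n (eta n) n2 eta01.
  have -> : X n = n%:R * al n by rewrite mulrC divfK// gt_eqF.
  have -> : N n = n%:R * be n by rewrite mulrC divfK// gt_eqF.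
  have bee : (eta n)^-1 * be n <= eta n.
    rewrite mulrC ler_pdivrMr// -expr2 etaE lerDl invr_ge0 ltW//.
  rewrite -/tau ln_div ?posrE// => h.
  have {}h : ln (x n) + theta0 / x n * al n <= ln tau + theta0 / tau * al n
      + 2 * (C * n%:R^-1 + C / b * (eta n * al n + (eta n)^-1 * be n)).
    rewrite -(ler_pM2l n0); apply: le_trans (le_trans h _); rewrite le_eqVlt; apply/orP; left; apply/eqP.
      by ring.
    by field; rewrite !gt_eqF.
  have Cb0 : 0 <= C / b by rewrite divr_ge0// ltW.
  have h2 := ler_wpM2l Cb0 bee.
  have h3 : theta0 * (al n - sigma02) * (tau^-1 - (x n)^-1) <=
      theta0 * `|al n - sigma02| * (tau^-1 + m^-1).
    rewrite -!(mulrA theta0) ler_pM2l//.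
    apply: (le_trans (ler_norm _)); rewrite normrM ler_wpM2l//.
    apply: (le_trans (ler_normB _ _)); rewrite !gtr0_norm ?invr_gt0// lerD2l.
    by rewrite lef_pV2.
  (* As theta0 * sigma02 = tau, this is exactly what separates the comparison [h] from u - 1 - ln u
     at u = tau / x. *)
  have h4 : theta0 * (al n - sigma02) * (tau^-1 - (x n)^-1) =
     theta0 / tau * al n - theta0 / x n * al n - 1 + tau / x n.
    by rewrite /tau; field; rewrite !gt_eqF.
  by rewrite /e; lra.
have sq : Num.sqrt (tau / x n) @[n --> \oo] --> (1 : R).
  have : Num.sqrt (tau / x n) - 1 @[n --> \oo] --> 0.
    by apply: (@cvg0_expr _ _ 1); exact: (squeeze_cvgr main (cvg_cst 0) e_cvg).
  move=> /cvgD /(_ (cvg_cst (1 : R))); rewrite add0r; apply: cvg_trans.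
  by apply: near_eq_cvg; apply: nearW => n; rewrite /= subrK.
have ux : (fun n => Num.sqrt (tau / x n) ^+ 2) @ \oo --> (1 : R).
  by rewrite -[X in _ --> X](expr1n _ 2); exact: (cvgM sq sq).
have {ux} ux : tau / (Num.sqrt (tau / x n) ^+ 2) @[n --> \oo] --> tau.
  rewrite -[X in _ --> X]divr1; apply: cvgM; first exact: cvg_cst.
  by apply: cvgV => //; exact: oner_neq0.
apply: cvg_trans ux; apply: near_eq_cvg; near=> n.
have n2 : (2 <= n)%N by near: n; exists 2%N.
have x0 : 0 < x n by apply: lt_le_trans (x_ge _ n2).
rewrite sqr_sqrtr ?divr_ge0 ?ltW//.
by field; rewrite !gt_eqF.
Unshelve. all: by end_near. Qed.

(** * Existence of minimizers by compactness *)

Section Existence.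
Variables (R : realType) (n : nat) (s : 'I_n -> R) (y : 'cV[R]_n).
Hypotheses (n_ge2 : (2 <= n)%N) (s_design : is_design s).

Let s_incr : strictly_increasing s. Proof. exact: design_incr. Qed.

Let cvg_expR (p : R * R) (h : R) :
  expR (- (q.1 * h)) @[q --> p] --> expR (- (p.1 * h)).
Proof.
apply: continuous_cvg; first exact: continuous_expR.
by apply: cvgN; apply: cvgM; [exact: cvg_fst|exact: cvg_cst].
Qed.

Let cvg_left_corr (p : R * R) i : left_corr q.1 s i @[q --> p] --> left_corr p.1 s i.
Proof. by rewrite /left_corr; case: ifP => _; [exact: cvg_cst|exact: cvg_expR]. Qed.

Let cvg_right_corr (p : R * R) i : right_corr q.1 s i @[q --> p] --> right_corr p.1 s i.
Proof. by rewrite /right_corr; case: ifP => _; [exact: cvg_cst|exact: cvg_expR]. Qed.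

Let cvg_den (p : R * R) (f g : R * R -> R) :
  f q @[q --> p] --> f p -> g q @[q --> p] --> g p ->
  1 - f q ^+ 2 * g q ^+ 2 @[q --> p] --> 1 - f p ^+ 2 * g p ^+ 2.
Proof.
move=> cf cg; apply: cvgB; first exact: cvg_cst.
by apply: cvgM; exact: cvgM.
Qed.

Let cvg_weight (p : R * R) (f g : R * R -> R) :
  f q @[q --> p] --> f p -> g q @[q --> p] --> g p ->
  1 - f p ^+ 2 * g p ^+ 2 != 0 ->
  pred_weight (f q) (g q) @[q --> p] --> pred_weight (f p) (g p).
Proof.
move=> cf cg fg0; apply: cvgM; last by apply: cvgV => //; exact: cvg_den.
apply: cvgM => //; apply: cvgB; first exact: cvg_cst.
exact: cvgM.
Qed.

Let cvg_var (p : R * R) (f g : R * R -> R) :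
  f q @[q --> p] --> f p -> g q @[q --> p] --> g p ->
  1 - f p ^+ 2 * g p ^+ 2 != 0 ->
  pred_var (f q) (g q) @[q --> p] --> pred_var (f p) (g p).
Proof.
move=> cf cg fg0; apply: cvgM; last by apply: cvgV => //; exact: cvg_den.
by apply: cvgM; apply: cvgB; (try exact: cvg_cst); exact: cvgM.
Qed.

Let cvg_score (p : R * R) : 0 < p.1 -> 0 < p.2 ->
  \sum_i (ln (q.2 * nbr_var q.1 s i) + std_err2 q.1 s (y^~ 0) i / q.2) @[q --> p]
  --> \sum_i (ln (p.2 * nbr_var p.1 s i) + std_err2 p.1 s (y^~ 0) i / p.2).
Proof.
move=> p1 p2; apply: cvg_big => [|i _]; first exact: add_continuous.
have v0 : 0 < nbr_var p.1 s i by exact: nbr_var_gt0.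
have d1 : 1 - left_corr p.1 s i ^+ 2 * right_corr p.1 s i ^+ 2 != 0.
  by rewrite gt_eqF// nbr_den_gt0.
have d2 : 1 - right_corr p.1 s i ^+ 2 * left_corr p.1 s i ^+ 2 != 0 by rewrite mulrC.
have cv : nbr_var q.1 s i @[q --> p] --> nbr_var p.1 s i.
  exact: cvg_var.
have cl : left_weight q.1 s i @[q --> p] --> left_weight p.1 s i.
  exact: cvg_weight.
have cr : right_weight q.1 s i @[q --> p] --> right_weight p.1 s i.
  exact: cvg_weight.
have c2 : q.2 @[q --> p] --> p.2 by exact: cvg_snd.
apply: cvgD.
  apply: continuous_cvg; last exact: cvgM.
  by apply: continuous_ln; rewrite mulr_gt0.
apply: cvgM; last by apply: cvgV => //; rewrite gt_eqF.
apply: cvgM; last by apply: cvgV => //; rewrite gt_eqF.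
have ce : y i 0 - nbr_mean q.1 s (y^~ 0) i @[q --> p] --> y i 0 - nbr_mean p.1 s (y^~ 0) i.
  apply: cvgB; first exact: cvg_cst.
  by apply: cvgD; apply: cvgM => //; exact: cvg_cst.
exact: cvgM.
Qed.

(** Continuity is checked on the explicit neighbour form of the score, where all denominators are
    positive, instead of on matrix inverses. *)
Lemma log_score_min (a A b B : R) : 0 < a -> a <= A -> 0 < b -> b <= B ->
  exists p, minimizes (fun q => log_score q.1 s y q.2) (`[a, A] `*` `[b, B]) p.
Proof.
move=> a0 aA b0 bB; set J := _ `*` _.
have J0 : J !=set0.
  by exists (a, b); split; rewrite /= in_itv/= lexx ?aA ?bB.
have cJ : compact J by apply: compact_setX; exact: segment_compact.
have Jpos q : J q -> 0 < q.1 /\ 0 < q.2.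
  by rewrite /J/= !in_itv/= => -[/andP[/(lt_le_trans a0) ? _] /andP[/(lt_le_trans b0) ? _]].
have [|c cJ' cmin] := compact_EVT_min (f := fun q : R * R =>
    \sum_i (ln (q.2 * nbr_var q.1 s i) + std_err2 q.1 s (y^~ 0) i / q.2)) J0 cJ.
  apply: continuous_in_subspaceT => q; rewrite inE => /Jpos[q1 q2].
  exact: cvg_score.
exists c; split; first by rewrite inE in cJ'.
move=> q Jq; have [q1 q2] := Jpos _ Jq; rewrite inE in cJ'; have [c1 c2] := Jpos _ cJ'.
by rewrite !log_scoreE//; apply: cmin; rewrite inE.
Qed.

End Existence.

(** * Almost sure limits and consistency *)

Section Consistency.
Context {d : measure_display} {T : measurableType d} {R : realType}.
Variables (P : probability T R) (theta0 sigma02 : R) (Y : R -> {RV P >-> R}).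
Variable s : forall n : nat, 'I_n -> R.
Hypotheses (theta0_gt0 : 0 < theta0) (sigma02_gt0 : 0 < sigma02).
Hypothesis Y_gaussian : centered_gaussian_process `[0, 1] Y
  (fun t1 t2 => sigma02 * exp_corr theta0 t1 t2).
Hypothesis s_design : forall n, (2 <= n)%N -> is_design (@s n).

Let X n w := total_err theta0 (@s n) (obs Y (@s n) w).
Let N n w := weighted_err theta0 (@s n) (obs Y (@s n) w).

Let X_cvg : {ae P, forall w, X n w / n%:R @[n --> \oo] --> sigma02}.
Proof.
pose u n w := centered_total_err theta0 sigma02 Y (@s n) w / n%:R.
have mu n : (2 <= n)%N -> has_moments P (u n).
  move=> n2; apply: has_momentsM; last exact: has_moments_cst.
  exact: has_moments_centered_total_err (s_design n2).
(* The shift by 2 keeps the sizes that carry a design; n + 2 >= n + 1 then gives the rate asked by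
   [ae_cvg0]. *)
have : {ae P, forall w, u n.+2 w ^+ 4 @[n --> \oo] --> 0}.
  apply: (@ae_cvg0 _ _ _ P (fun n w => u n.+2 w ^+ 4) (64 * (dfact R 4 + 1))).
  - by move=> n; apply: has_momentsX; exact: mu.
  - by move=> n w; rewrite (exprM _ 2 2) sqr_ge0.
  move=> n; have n2 : (2 <= n.+2)%N by [].
  have n0 : 0 < n.+2%:R :> R by [].
  have C0 : 0 <= 64 * (dfact R 4 + 1) by rewrite mulr_ge0// addr_ge0// prodr_ge0.
  have := Ex_centered_total_err4 theta0_gt0 sigma02_gt0 Y_gaussian n2 (s_design n2).
  under [X in Ex P X]eq_fun do rewrite -[centered_total_err _ _ _ _ _](divfK (lt0r_neq0 n0)) exprMn mulrC.
  rewrite ExZ; last by apply: has_momentsX; exact: mu.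
  set EU := Ex _ _ => EU_le; apply: (@le_trans _ _ (64 * (dfact R 4 + 1) / n.+2%:R ^+ 2)).
    rewrite ler_pdivlMr ?exprn_gt0// -(ler_pM2l (exprn_gt0 2 n0)).
    by apply: le_trans (le_trans EU_le _); rewrite le_eqVlt; apply/orP; left; apply/eqP; ring.
  rewrite ler_wpM2l// lef_pV2 ?posrE ?exprn_gt0//.
  by rewrite lerXn2r ?nnegrE// ler_nat.
apply: filterS => w uw.
have u0 : u n w @[n --> \oo] --> 0.
  rewrite -(cvg_shiftS (u^~ w)) -(cvg_shiftS (fun n => u n.+1 w)).
  exact: (cvg0_expr uw).
have : sigma02 * u n w + sigma02 @[n --> \oo] --> sigma02 * 0 + sigma02.
  by apply: cvgD; [apply: cvgM => //|]; exact: cvg_cst.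
rewrite mulr0 add0r; apply: cvg_trans; apply: near_eq_cvg; near=> n.
have n0 : n%:R != 0 :> R by rewrite pnatr_eq0 -lt0n; near: n; exists 1%N.
by rewrite /u /centered_total_err -/(X n w); field; rewrite n0 gt_eqF.
Unshelve. all: by end_near. Qed.

(** A second moment is enough: that of [weighted_err] stays bounded, so division by n^2 is already
    summable. *)
Let N_cvg : {ae P, forall w, N n w / n%:R @[n --> \oo] --> 0}.
Proof.
pose u n w := N n w / n%:R.
have mu n : (2 <= n)%N -> has_moments P (u n).
  move=> n2; apply: has_momentsM; last exact: has_moments_cst.
  by apply: (has_moments_weighted_err theta0_gt0 sigma02_gt0 Y_gaussian n2 (s_design n2)).
have : {ae P, forall w, u n.+2 w ^+ 2 @[n --> \oo] --> 0}.
  apply: (@ae_cvg0 _ _ _ P (fun n w => u n.+2 w ^+ 2) (108 * sigma02 ^+ 2)).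
  - by move=> n; apply: has_momentsX; exact: mu.
  - by move=> n w; rewrite sqr_ge0.
  move=> n; have n2 : (2 <= n.+2)%N by [].
  have n0 : 0 < n.+2%:R :> R by [].
  have C0 : 0 <= 108 * sigma02 ^+ 2 by rewrite mulr_ge0// sqr_ge0.
  have := Ex_weighted_err2 theta0_gt0 sigma02_gt0 Y_gaussian n2 (s_design n2).
  under [X in Ex P X]eq_fun do rewrite -[weighted_err _ _ _](divfK (lt0r_neq0 n0)) exprMn mulrC.
  rewrite ExZ; last by apply: has_momentsX; exact: mu.
  set EU := Ex _ _ => EU_le; apply: (@le_trans _ _ (108 * sigma02 ^+ 2 / n.+2%:R ^+ 2)).
    by rewrite ler_pdivlMr ?exprn_gt0// mulrC.
  rewrite ler_wpM2l// lef_pV2 ?posrE ?exprn_gt0//.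
  by rewrite lerXn2r ?nnegrE// ler_nat.
apply: filterS => w uw.
rewrite -(cvg_shiftS (u^~ w)) -(cvg_shiftS (fun n => u n.+1 w)).
exact: (cvg0_expr uw).
Qed.

(** Minimality is used against a single competitor, the given point with product theta0 * sigma02.
    The rectangle may be degenerate, which covers the one-parameter estimators. *)
Lemma minimizer_product_cvg (a A b B : R) (thetah sigma2h : nat -> T -> R) :
  0 < a -> a <= A -> 0 < b -> b <= B ->
  (exists2 p : R * R, (`[a, A] `*` `[b, B])%classic p & p.1 * p.2 = theta0 * sigma02) ->
  (forall n w, (2 <= n)%N -> minimizes (fun q => score Y s n w q.1 q.2)
     (`[a, A] `*` `[b, B]) (thetah n w, sigma2h n w)) ->
  {ae P, forall w, thetah n w * sigma2h n w @[n --> \oo] --> theta0 * sigma02}.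
Proof.
move=> a0 aA b0 bB [[th s2] /= [+ +] ts] hmin.
rewrite /= !in_itv/= => tI sI.
have [C C0 expansion] := log_score_expansion theta0_gt0 a0 aA.
apply: filterS2 X_cvg N_cvg => w Xw Nw.
have Jpos n : (2 <= n)%N -> a <= thetah n w <= A /\ b <= sigma2h n w <= B.
  by move=> n2; have [] := hmin n w n2; rewrite /= !in_itv/= => -[].
apply: (@argmin_cvg R theta0 sigma02 C b (a * b) _ (X^~ w) (N^~ w)) => //.
- exact: mulr_gt0.
- move=> n n2; split.
    by apply: sumr_ge0 => i _; apply: std_err2_ge0 => //; exact: s_design.
  apply: sumr_ge0 => i _; rewrite mulr_ge0 ?nbr_len_ge0//; first exact: s_design.
  by rewrite addr_ge0 ?nbr_sqr_ge0// std_err2_ge0//; exact: s_design.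
- move=> n n2; have [/andP[? _] /andP[? _]] := Jpos n n2.
  by apply: ler_pM => //; exact: ltW.
move=> n eta n2 eta01; have [tn sn] := Jpos n n2.
have [_ /(_ (th, s2))] := hmin n w n2; rewrite /= !in_itv/= => /(_ (conj tI sI)).
rewrite /score => smin.
have pos x : b <= x <= B -> 0 < x by move=> /andP[/(lt_le_trans b0)].
set y := \col_i _ in smin.
have yE : y^~ 0 = obs Y (@s n) w by apply/funext => i; rewrite mxE.
(* The score is expanded at the minimizer and at the competitor; the parameter-free sum cancels, and
   the two remainders explain the factor 2 in [argmin_cvg]. *)
have := expansion n (@s n) y eta _ _ n2 (s_design n2) eta01 tn (pos _ sn).
have := expansion n (@s n) y eta _ _ n2 (s_design n2) eta01 tI (pos _ sI).
rewrite yE -/(X n w) -/(N n w) ts.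
have [X0 N0] : 0 <= X n w /\ 0 <= N n w.
  split.
    by apply: sumr_ge0 => i _; apply: std_err2_ge0 => //; exact: s_design.
  apply: sumr_ge0 => i _; rewrite mulr_ge0 ?nbr_len_ge0//; first exact: s_design.
  by rewrite addr_ge0 ?nbr_sqr_ge0// std_err2_ge0//; exact: s_design.
set E := eta * X n w + eta^-1 * N n w.
have E0 : 0 <= E.
  case/andP: eta01 => eta0 _.
  by rewrite addr_ge0// mulr_ge0// ?invr_ge0 ltW.
have Cle x : b <= x <= B -> C / x * E <= C / b * E.
  move=> xI; have x0 := pos _ xI; case/andP: xI => bx _.
  by rewrite ler_wpM2r// ler_wpM2l ?lef_pV2// ltW.
have := Cle _ sn; have := Cle _ sI.
by rewrite !ler_norml => ? ? /andP[? ?] /andP[? ?]; lra.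
Qed.

End Consistency.

Theorem theorem3p2 (R : realType) (d : measure_display) (T : measurableType d)
    (P : probability T R) (theta0 sigma02 : R) (Y : R -> {RV P >-> R})
    (s : forall n : nat, 'I_n -> R) (a A b B : R) :
  0 < theta0 -> 0 < sigma02 ->
  centered_gaussian_process `[0, 1] Y
    (fun t1 t2 => sigma02 * exp_corr theta0 t1 t2) ->
  (forall n, (2 <= n)%N -> is_design (s n)) ->
  limn_esup (fun n => (max_spacing (s n))%:E) = 0%E ->
  0 < a -> a <= A -> 0 < b -> b <= B ->
  let J : set (R * R) := `[a, A] `*` `[b, B] in
  ((exists2 p : R * R, J p & p.1 * p.2 = theta0 * sigma02) ->
     (forall n w, (2 <= n)%N ->
        exists p, minimizes (fun q => score Y s n w q.1 q.2) J p) /\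
     (forall thetah sigma2h : nat -> T -> R,
        (forall n w, (2 <= n)%N ->
           minimizes (fun q => score Y s n w q.1 q.2) J
             (thetah n w, sigma2h n w)) ->
        {ae P, forall w,
           thetah n w * sigma2h n w @[n --> \oo] --> theta0 * sigma02})) /\
  (forall sigma12 theta2 : R,
     0 < sigma12 -> 0 < theta2 ->
     a <= sigma02 * theta0 / sigma12 <= A ->
     b <= sigma02 * theta0 / theta2 <= B ->
     [/\ forall n w, (2 <= n)%N ->
           exists th, minimizes (fun th' => score Y s n w th' sigma12)
                        `[a, A] th,
         forall n w, (2 <= n)%N ->
           exists s2, minimizes (score Y s n w theta2) `[b, B] s2,
         forall thetah1 : nat -> T -> R,
           (forall n w, (2 <= n)%N ->
              minimizes (fun th => score Y s n w th sigma12) `[a, A]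
                (thetah1 n w)) ->
           {ae P, forall w,
              thetah1 n w @[n --> \oo] --> sigma02 * theta0 / sigma12} &
         forall sigma2h2 : nat -> T -> R,
           (forall n w, (2 <= n)%N ->
              minimizes (score Y s n w theta2) `[b, B] (sigma2h2 n w)) ->
           {ae P, forall w,
              sigma2h2 n w @[n --> \oo] --> sigma02 * theta0 / theta2}]).
Proof.
move=> t00 s00 gY ds _ a0 aA b0 bB J.
have point (x y : R) : y \in `[x, x] -> y = x.
  by rewrite in_itv/= => /andP[? ?]; apply/eqP; rewrite eq_le; apply/andP.
split=> [Jtau|s1 t2 s10 t20 t1I s2I].
  split=> [n w n2|th s2 hmin]; first exact: (log_score_min (\col_i Y (s n i) w) n2 (ds n n2) a0 aA b0 bB).
  exact: (minimizer_product_cvg t00 s00 gY ds a0 aA b0 bB Jtau hmin).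
split.
(* Fixing one parameter amounts to minimizing over a rectangle with one side reduced to a point. *)
- move=> n w n2; have [[th s2] [[/= thI /point ->]] smin] := log_score_min
    (\col_i Y (s n i) w) n2 (ds n n2) a0 aA s10 (lexx s1).
  exists th; split => // th' th'I.
  by apply: (smin (th', s1)); split => //=; rewrite in_itv/= lexx.
- move=> n w n2; have [[th s2] [[/= /point -> s2I']] smin] := log_score_min
    (\col_i Y (s n i) w) n2 (ds n n2) t20 (lexx t2) b0 bB.
  exists s2; split => // s2' s2'I.
  by apply: (smin (t2, s2')); split => //=; rewrite in_itv/= lexx.
- move=> th hmin; have tau_mem : exists2 p : R * R,
      (`[a, A] `*` `[s1, s1])%classic p & p.1 * p.2 = theta0 * sigma02.
    exists (sigma02 * theta0 / s1, s1) => /=; last by field; rewrite gt_eqF.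
    by split; rewrite /= in_itv/= ?lexx.
  have prod_cvg : {ae P, forall w, th n w * s1 @[n --> \oo] --> theta0 * sigma02}.
    apply: (minimizer_product_cvg t00 s00 gY ds a0 aA s10 (lexx s1) tau_mem
      (sigma2h := fun _ _ => s1)) => n w n2.
    have [thI thmin] := hmin n w n2; split => /=.
      by split => //=; rewrite in_itv/= lexx.
    by move=> [th' s2'] /= [th'I /point ->]; exact: thmin.
  apply: filterS prod_cvg => w thc; rewrite (mulrC sigma02).
  have : th n w * s1 / s1 @[n --> \oo] --> theta0 * sigma02 / s1.
    by apply: cvgM => //; exact: cvg_cst.
  apply: cvg_trans; apply: near_eq_cvg; apply: nearW => n.
  by rewrite mulfK ?gt_eqF.
- move=> s2 hmin; have tau_mem : exists2 p : R * R,
      (`[t2, t2] `*` `[b, B])%classic p & p.1 * p.2 = theta0 * sigma02.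
    exists (t2, sigma02 * theta0 / t2) => /=; last by field; rewrite gt_eqF.
    by split; rewrite /= in_itv/= ?lexx.
  have prod_cvg : {ae P, forall w, t2 * s2 n w @[n --> \oo] --> theta0 * sigma02}.
    apply: (minimizer_product_cvg t00 s00 gY ds t20 (lexx t2) b0 bB tau_mem
      (thetah := fun _ _ => t2)) => n w n2.
    have [sI smin] := hmin n w n2; split => /=.
      by split => //=; rewrite in_itv/= lexx.
    by move=> [th' s2'] /= [/point -> s2I']; exact: smin.
  apply: filterS prod_cvg => w sc; rewrite (mulrC sigma02).
  have : t2 * s2 n w / t2 @[n --> \oo] --> theta0 * sigma02 / t2.
    by apply: cvgM => //; exact: cvg_cst.
  apply: cvg_trans; apply: near_eq_cvg; apply: nearW => n.
  by rewrite mulrAC divff ?mul1r ?gt_eqF.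
Qed.
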